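(* Let $X_1,X_2,\dots$ be independent random variables with continuous distribution functions, such that $\mathbf{E}X_i=0$ and $\mathbf{P}(|X_i|\le M_i)=1$ for all $i\ge1$, where $M_1,M_2,\dots$ are deterministic. Let $\{u_{k,n},G_{k,n}\}_{1\le k\le n,\ n\ge1}$ be deterministic real numbers such that $$M:=\sup_{k,n}\left(|u_{k,n}|M_k+|G_{k,n}|\right)<\infty,\qquad \sigma_n^2:=\sum_{k=1}^n u_{k,n}^2\,\mathbf{E}X_k^2\to\infty\quad(n\to\infty),$$ and, for real numbers $u_k$, $g_k$, $$u_{k,n}\to u_k\quad\text{and}\quad G_{k,n}\to g_k\quad\text{as }n\to\infty,\ \text{for every }k\ge1.$$ Then, as $n\to\infty$, $$\sigma_n\,\mathbf{P}(\tau_n>n)\to\sqrt{\frac{2}{\pi}}\;\mathbf{E}[-U_\tau]\in[0,\infty).$$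
   Context: For $1\le k\le n$ put $U_{k,n}:=u_{1,n}X_1+\dots+u_{k,n}X_k$ and $\tau_n:=\inf\{k\ge1:\ U_{k,n}\le G_{k,n}\}$, so $\{\tau_n>n\}=\{\min_{1\le k\le n}(U_{k,n}-G_{k,n})>0\}$. For $k\ge1$ put $U_k:=u_1X_1+\dots+u_kX_k$ and $\tau:=\inf\{k\ge1:\ U_k\le g_k\}$. The supremum defining $M$ is over all indices $1\le k\le n$, $n\ge1$.
   Formalization: Two assumptions are added: τ is finite almost surely (else U_τ is undefined), and there is no k with u_1=…=u_k=0, g_1,…,g_{k-1}<0 and g_k=0 (else false, e.g. u_{1,n}=0, G_{1,n}=-1/n, then u_{k,n}=1, G_{k,n}=-1). *)

(* Defs.v *)
From HB Require Import structures.
From mathcomp Require Import all_boot all_order all_algebra finmap.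
From mathcomp Require Import all_classical all_reals all_analysis.

Set Implicit Arguments.
Unset Strict Implicit.
Unset Printing Implicit Defensive.

Import Order.TTheory GRing.Theory Num.Theory.
Import numFieldNormedType.Exports.

Local Open Scope classical_set_scope.
Local Open Scope ring_scope.

(* Sequences are indexed by k >= 1; values at index 0 are never used.  A
   triangular array a_{k,n} is [a k n]; only the entries with 1 <= k <= n
   matter. *)

(* Mutual independence of the variables X_i, i in A. *)
Definition independent_RVs (d : measure_display) (T : measurableType d)
    (R : realType) (P : probability T R) (A : set nat)
    (X : nat -> {RV P >-> R}) : Prop :=
  forall (J : {fset nat}) (B : nat -> set R),
    [set` J] `<=` A ->
    (forall i, i \in J -> measurable (B i)) ->
    P (\bigcap_(i in [set` J]) (X i @^-1` B i))
      = (\prod_(i <- J) P (X i @^-1` B i))%E.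

Definition weighted_sum (d : measure_display) (T : measurableType d)
    (R : realType) (P : probability T R) (X : nat -> {RV P >-> R})
    (a : nat -> R) (w : T) (k : nat) : R :=
  \sum_(1 <= i < k.+1) a i * X i w.

(* inf {k >= 1 : s k <= b k}, with None for the infimum of the empty set. *)
Definition first_passage (R : realType) (s b : nat -> R) : option nat :=
  match pselect (exists k, (0 < k)%N && (s k <= b k)) with
  | left h => Some (ex_minn h)
  | right _ => None
  end.

Definition passage_after (t : option nat) (n : nat) : bool :=
  if t is Some k then (n < k)%N else true.

(* s_t; the value 0 at t = None is arbitrary. *)
Definition stopped (R : realType) (s : nat -> R) (t : option nat) : R :=
  if t is Some k then s k else 0.

(* sigma_n^2 = sum_{k=1}^n u_{k,n}^2 E[X_k^2] *)
Definition row_variance (d : measure_display) (T : measurableType d)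
    (R : realType) (P : probability T R) (X : nat -> {RV P >-> R})
    (u : nat -> nat -> R) (n : nat) : R :=
  \sum_(1 <= k < n.+1) u k n ^+ 2 * fine ('E_P[fun w => (X k w ^+ 2)%R])%E.

(* The limiting weights ul and boundary gl stop the walk at its first step k
   where ul_1 = ... = ul_k = 0 = gl_k: the partial sum is then identically 0
   and touches the boundary without crossing it, although the X_i have no
   atoms.  The stopping times of the approximating rows then need not converge
   to that of the limit: with P(|X_i| <= 1) = 1, u_{1,n} = 0, G_{1,n} = -1/n
   and u_{k,n} = 1, G_{k,n} = -1 for k >= 2, the limiting stopping time is 1,
   while the row n survives its first step. *)
Definition degenerate_contact (R : realType) (ul gl : nat -> R) : Prop :=
  exists k : nat,
    [/\ (0 < k)%N,
        forall j, (1 <= j <= k)%N -> ul j = 0,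
        forall j, (1 <= j < k)%N -> gl j < 0 &
        gl k = 0].

(* Main.v *)
Require Import Defs.
From HB Require Import structures.
From mathcomp Require Import all_boot all_order all_algebra finmap.
From mathcomp Require Import all_classical all_reals all_analysis.
From mathcomp Require Import measurable_realfun.
From mathcomp Require Import ring lra.

Set Implicit Arguments.
Unset Strict Implicit.
Unset Printing Implicit Defensive.

Import Order.TTheory GRing.Theory Num.Theory.
Import numFieldNormedType.Exports.

Local Open Scope classical_set_scope.
Local Open Scope ring_scope.

(* Write S_k for the walk of row n, tau for its exit time, s_k^2 for the variance
   of its k-th step, V_k for the variance of S_k, sigma^2 = V_n, and
   F(x, t) = erf(x / sqrt(2 t)), the solution of the heat equation on the line
   with initial value sgn.  With the regularised remaining time
   t_k = V_n - V_k + delta^2 sigma^2 / 2, the process F(S_k, t_k) is a martingale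
   up to an error of order M s_k^2 t_k^(-3/2) per step.  Stopping it at tau gives
     E[F(S_n, t_n); tau > n] = E[-F(S_tau, t_tau); tau <= n] + error.
   The overshoot S_tau is bounded and t_tau ~ (1 + delta^2 / 2) sigma^2 for fixed
   tau, so the right-hand side times sigma converges to a multiple of E[-U_tau]
   by dominated convergence.  The left-hand side is P(tau > n) up to the event
   {tau > n, |S_n| <= l delta sigma}, whose probability is small compared with
   1 / sigma by an anticoncentration bound applied after a time m with
   V_m <= V_n / 4, at which survival has probability O(1 / sigma).  This last
   estimate, P(tau > m) = O(V_m^(-1/2)), is obtained by bootstrapping the same
   anticoncentration bound with E[S_m; tau > m] <= 2 M.  Finally delta -> 0. *)

(** * The error function *)

(** The obstacle is the size of the error: everything is multiplied by sigma, so the heat-equation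
    error must be o(1 / sigma). Since sqrt(2 t_k) >= rho = delta sigma, every step error carries the
    factor M / rho^3; summed against the bare variances this gives V_n / sigma^3 = 1 / sigma, just
    too large. A step counts only while the walk is alive, so the variances are weighted by P(tau >
    k), and the survival bound lowers the weighted sum to O(sigma^(3/2)). Hence the crude estimate
    of P(tau > m) has to precede the sharp asymptotics. Its bootstrap closes because V_m is
    comparable with V_n from both sides: anticoncentration gains a factor 1/4, while passing from
    sqrt V_m to sigma loses only a factor 3. The initial value sgn serves three ends: F vanishes at
    the starting point 0, it is close to 1 for survivors, which typically sit at height of order
    sigma, and it is linear to first order at the bounded exit positions, so that only the mean of
    S_tau matters. *)

(* erf0 x = (sqrt pi / 2) erf x *)
HB.lock Definition erf0 {R : realType} (x : R) : R :=
  \int[lebesgue_measure]_(t in `]-oo, x]) gauss_fun t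
  - \int[lebesgue_measure]_(t in `]-oo, 0]) gauss_fun t.

Section error_function.
Context {R : realType}.
Implicit Types (f : R -> R) (x y z h v : R).
Local Notation leb := (@lebesgue_measure R).

(** The derivative is bounded only on the ball around [a] through [b]. This lets the estimate be
    iterated: a bound on one derivative, itself growing with the distance to [a], bounds the
    previous one. *)
Lemma derive_lipschitz f df (K : R) (a b : R) :
  (forall x, is_derive x (1 : R) f (df x)) ->
  (forall x, `|x - a| <= `|b - a| -> `|df x| <= K) ->
  `|f b - f a| <= K * `|b - a|.
Proof.
move=> fdf dfK.
have cf : continuous f.
  by move=> x; apply/differentiable_continuous/derivable1_diffP; case: (fdf x).
have [ab|ba] := leP a b.
  have [c cab ->] := MVT_segment ab (fun x _ => fdf x) (continuous_subspaceT cf).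
  rewrite normrM ler_wpM2r//; apply: dfK.
  move: cab; rewrite in_itv/= => /andP[ac cb].
  by rewrite !ger0_norm ?subr_ge0// lerB.
have [c cab E] := MVT_segment (ltW ba) (fun x _ => fdf x) (continuous_subspaceT cf).
rewrite distrC E normrM (distrC a b) ler_wpM2r//; apply: dfK.
move: cab; rewrite in_itv/= => /andP[ac cb].
by rewrite !ler0_norm ?subr_le0// ?(ltW ba)// lerN2 lerB.
Qed.

Let gauss_int (A : set R) : measurable A -> leb.-integrable A (EFin \o gauss_fun).
Proof. by move=> mA; apply: integrableS integrableT_gauss. Qed.

(** Both integrals in [erf0] start at minus infinity, so one application of the fundamental theorem
    covers both signs of [x]; [x + 1] is merely an endpoint beyond [x]. *)
Lemma is_derive_erf0 x : is_derive x (1 : R) erf0 (gauss_fun x).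
Proof.
have [||D E] := @continuous_FTC1 R gauss_fun -oo%O x (x + 1)
  (_ : x < x + 1) (gauss_int (measurable_itv _)) _ (@continuous_gauss_fun R x).
- by rewrite ltrDl.
- by rewrite ltNyr.
have -> : erf0 = (fun y => \int[leb]_(t in `]-oo, y]) gauss_fun t) -
    cst (\int[leb]_(t in `]-oo, 0]) gauss_fun t) by apply/funext => y; rewrite erf0.unlock.
apply: is_derive_eq; last exact: subr0.
apply: is_deriveB.
by apply: DeriveDef; [exact: D|rewrite -derive1E; exact: E].
Qed.

(** The polynomial is (1 + y/2)^2 with y = x^2, at most exp(y). This single inequality yields all
    the bounds on polynomial multiples of the Gaussian below. *)
Lemma gauss_funM x : gauss_fun x * (1 + x ^+ 2 + x ^+ 4 / 4) <= 1.
Proof.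
have e0 : 0 < gauss_fun x by exact: expR_gt0.
rewrite [X in _ <= X](_ : 1 = gauss_fun x * expR (x ^+ 2)); last first.
  by rewrite /gauss_fun -expRD addNr expR0.
rewrite ler_pM2l//.
have -> : expR (x ^+ 2) = expR (x ^+ 2 / 2) ^+ 2.
  by rewrite [RHS]expr2 -expRD; congr expR; field.
have := @expR_ge1Dx R (x ^+ 2 / 2) => h.
have : (1 + x ^+ 2 / 2) ^+ 2 <= expR (x ^+ 2 / 2) ^+ 2.
  by rewrite lerXn2r// nnegrE ?expR_ge0// addr_ge0// divr_ge0// sqr_ge0.
apply: le_trans; rewrite le_eqVlt; apply/orP; left; by apply/eqP; field.
Qed.

Lemma normM_gauss_le1 x : `|x * gauss_fun x| <= 1.
Proof.
have := gauss_funM x; have := @gauss_fun_ge0 R x; set e := gauss_fun x => e0 H.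
rewrite normrM (ger0_norm e0); apply: le_trans H; rewrite mulrC ler_wpM2l//.
have := sqr_ge0 (`|x| - 1); have := sqr_ge0 (x ^+ 2).
have -> : (`|x| - 1) ^+ 2 = x ^+ 2 - 2 * `|x| + 1.
  by rewrite -(real_normK (num_real x)); ring.
have := normr_ge0 x; nra.
Qed.

Lemma normX3M_gauss_le1 x : `|x ^+ 3 * gauss_fun x| <= 1.
Proof.
have := gauss_funM x; have := @gauss_fun_ge0 R x; set e := gauss_fun x => e0 H.
rewrite normrM (ger0_norm e0); apply: le_trans H; rewrite mulrC ler_wpM2l//.
rewrite normrX.
have -> : x ^+ 2 = `|x| ^+ 2 by rewrite real_normK// num_real.
have -> : x ^+ 4 = `|x| ^+ 4.
  by rewrite -[4%N]/(2 * 2)%N !exprM real_normK// num_real.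
have := normr_ge0 x; move: (`|x|) => y y0.
have : 0 <= (y * (1 - y / 2)) ^+ 2 by exact: sqr_ge0.
have -> : (y * (1 - y / 2)) ^+ 2 = y ^+ 2 - y ^+ 3 + y ^+ 4 / 4 by field.
lra.
Qed.

Lemma is_derive_gauss x : is_derive x (1 : R) gauss_fun (- 2 * x * gauss_fun x).
Proof.
rewrite /gauss_fun.
apply: is_derive_eq.
rewrite /GRing.scale/=; ring.
Qed.

Lemma is_derive_gauss2 x :
  is_derive x (1 : R) (fun y => - 2 * y * gauss_fun y)
    ((4 * x ^+ 2 - 2) * gauss_fun x).
Proof.
have ? := is_derive_gauss x.
apply: is_derive_eq.
rewrite /GRing.scale/=; ring.
Qed.

Lemma norm_gauss2_le2 x : `|(4 * x ^+ 2 - 2) * gauss_fun x| <= 2.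
Proof.
have := gauss_funM x; have := @gauss_fun_ge0 R x; set e := gauss_fun x => e0 H.
have h2 := sqr_ge0 x; have h4 : 0 <= (x ^+ 2 - 2) ^+ 2 := sqr_ge0 _.
have E4 : x ^+ 4 = x ^+ 2 * x ^+ 2 by rewrite -exprD.
rewrite E4 in H.
have E : (x ^+ 2 - 2) ^+ 2 = x ^+ 2 * x ^+ 2 - 4 * x ^+ 2 + 4 by ring.
rewrite E in h4; move: (x ^+ 2) h2 h4 H {E4 E} => y h2 h4 H.
have P1 := mulr_ge0 e0 h2; have P2 := mulr_ge0 e0 h4.
rewrite ler_norml; apply/andP; split; nra.
Qed.

(** Taylor expansion with erf0'' z = -2 z [gauss_fun z] and a third derivative bounded by 2. Three
    uses of [derive_lipschitz] lose the factorial in the remainder, which is harmless. *)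
Lemma erf0_taylor z h :
  `|erf0 (z + h) - erf0 z - h * gauss_fun z + h ^+ 2 * z * gauss_fun z|
  <= 2 * `|h| ^+ 3.
Proof.
pose f1 h := gauss_fun (z + h) - gauss_fun z + 2 * h * z * gauss_fun z.
pose f2 h := (- 2 * (z + h) * gauss_fun (z + h)) - (- 2 * z * gauss_fun z).
have d1 t : is_derive t (1 : R) f1 (f2 t).
  rewrite /f1.
  have ? : is_derive t (1 : R) (fun h => gauss_fun (z + h)) (- 2 * (z + t) * gauss_fun (z + t)).
    have ? := is_derive_gauss (z + t).
    have ? : is_derive t (1:R) (fun h => z + h) 1.
      by apply: is_derive_eq; rewrite /GRing.scale/=; ring.
    apply: (@is_derive_eq _ _ _ _ _ _ _ _ (is_derive1_comp _ _)).
    by rewrite /GRing.scale/=; ring.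
  apply: is_derive_eq; rewrite /f2 /GRing.scale/=; ring.
pose f0 h := erf0 (z + h) - erf0 z - h * gauss_fun z + h ^+ 2 * z * gauss_fun z.
have d0 t : is_derive t (1 : R) f0 (f1 t).
  rewrite /f0.
  have ? : is_derive t (1 : R) (fun h => erf0 (z + h)) (gauss_fun (z + t)).
    have ? := is_derive_erf0 (z + t).
    have ? : is_derive t (1:R) (fun h => z + h) 1.
      by apply: is_derive_eq; rewrite /GRing.scale/=; ring.
    apply: (@is_derive_eq _ _ _ _ _ _ _ _ (is_derive1_comp _ _)).
    by rewrite /GRing.scale/=; ring.
  apply: is_derive_eq; rewrite /f1 /GRing.scale/=; ring.
have b2 t : `|f2 t| <= 2 * `|t|.
  have := @derive_lipschitz (fun y => - 2 * y * gauss_fun y) _ 2 z (z + t)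
    is_derive_gauss2 (fun x _ => norm_gauss2_le2 x).
  by rewrite [z + t]addrC addrK addrC.
have b1 t : `|f1 t| <= 2 * `|t| ^+ 2.
  have := @derive_lipschitz f1 f2 (2 * `|t|) 0 t d1.
  rewrite !subr0 expr2 mulrA => H.
  rewrite -[f1 t](_ : f1 t - f1 0 = _); last first.
    by rewrite /f1 addr0; ring.
  apply: H => x; rewrite subr0 => xt.
  by rewrite (le_trans (b2 x))// ler_wpM2l.
have := @derive_lipschitz f0 f1 (2 * `|h| ^+ 2) 0 h d0.
rewrite !subr0 (_ : 2 * `|h| ^+ 2 * `|h| = 2 * `|h| ^+ 3); last by ring.
move=> H.
rewrite -[X in `|X|](_ : f0 h - f0 0 = _); last first.
  by rewrite /f0 addr0; ring.
apply: H => x; rewrite subr0 => xt.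
by rewrite (le_trans (b1 x))// ler_wpM2l// lerXn2r// nnegrE.
Qed.

(** The effect of one time step on the space scale: l = (1 + v)^(-1/2) is 1 - v/2 up to order v^2.
    The expansion is made in l around 1, where the second derivative of erf0 (l z) stays bounded
    uniformly in z thanks to the Gaussian factor. *)
Lemma erf0_dilation z v l : 0 <= v <= 1 -> 0 <= l -> l ^+ 2 * (1 + v) = 1 ->
  `|erf0 (l * z) - erf0 z + v / 2 * z * gauss_fun z| <= 9 * v ^+ 2.
Proof.
move=> /andP[v0 v1] l0 lv.
have l1 : l <= 1.
  rewrite leNgt; apply/negP => l1; have : 1 < l ^+ 2 by rewrite expr_gt1.
  nra.
have l12 : 1 / 2 <= l by rewrite leNgt; apply/negP => l12; nra.
have E1 : (1 - l) * (1 + l) = l ^+ 2 * v.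
  by nra.
have l2 : l ^+ 2 <= 1 by rewrite expr_le1.
have lle : 1 - l <= v by nra.
pose f1 t := z * gauss_fun (t * z) - z * gauss_fun z.
have dl t : is_derive t (1:R) (fun t => t * z) z.
  by apply: is_derive_eq; rewrite /GRing.scale/=; ring.
have d1 t : is_derive t (1 : R) f1 (- 2 * t * z ^+ 3 * gauss_fun (t * z)).
  rewrite /f1.
  have ? : is_derive t (1 : R) (fun t => gauss_fun (t * z))
      (z * (- 2 * (t * z) * gauss_fun (t * z))).
    have ? := is_derive_gauss (t * z); have ? := dl t.
    apply: (@is_derive_eq _ _ _ _ _ _ _ _ (is_derive1_comp _ _)).
    by rewrite /GRing.scale/=; ring.
  apply: is_derive_eq; rewrite /GRing.scale/=; ring.
pose f0 t := erf0 (t * z) - erf0 z - (t - 1) * z * gauss_fun z.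
have d0 t : is_derive t (1 : R) f0 (f1 t).
  rewrite /f0.
  have ? : is_derive t (1 : R) (fun t => erf0 (t * z)) (z * gauss_fun (t * z)).
    have ? := is_derive_erf0 (t * z); have ? := dl t.
    apply: (@is_derive_eq _ _ _ _ _ _ _ _ (is_derive1_comp _ _)).
    by rewrite /GRing.scale/=; ring.
  apply: is_derive_eq; rewrite /f1 /GRing.scale/=; ring.
(* Intermediate points stay above 1/2 because 1 - l <= 1/2; this gives 2 / t^2 <= 8 in the next
   bound, whatever z. *)
have near1 t : `|t - 1| <= `|l - 1| -> 1 / 2 <= t.
  by rewrite [X in _ <= X]ler0_norm ?subr_le0// ler_norml => /andP[+ _]; lra.
have b2 t : `|t - 1| <= `|l - 1| -> `|- 2 * t * z ^+ 3 * gauss_fun (t * z)| <= 8.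
  move=> /near1 t12; have t0 : 0 < t by lra.
  have -> : - 2 * t * z ^+ 3 * gauss_fun (t * z) =
      (- 2 / t ^+ 2) * ((t * z) ^+ 3 * gauss_fun (t * z)).
    by field; rewrite gt_eqF.
  rewrite normrM -[8]mulr1 ler_pM ?normX3M_gauss_le1//.
  rewrite normrM normrN normfV normrX !ger0_norm// ?(ltW t0)//.
  rewrite ler_pdivrMr ?exprn_gt0//; nra.
have b1 t : `|t - 1| <= `|l - 1| -> `|f1 t| <= 8 * `|l - 1|.
  move=> tl; have := @derive_lipschitz f1 _ 8 1 t d1.
  rewrite [f1 1](_ : _ = 0) ?subr0; last by rewrite /f1 mul1r subrr.
  move=> H; apply: le_trans (H _) _; last by rewrite ler_wpM2l.
  by move=> x xt; apply: b2; apply: le_trans xt tl.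
have := @derive_lipschitz f0 f1 (8 * `|l - 1|) 1 l d0 b1.
rewrite [f0 1](_ : _ = 0) ?subr0; last by rewrite /f0 mul1r; ring.
rewrite (_ : 8 * `|l - 1| * `|l - 1| = 8 * (1 - l) ^+ 2); last first.
  by rewrite -mulrA -[_ * `|_|]expr2 real_normK ?num_real// -sqrrN opprB.
move=> H.
have -> : erf0 (l * z) - erf0 z + v / 2 * z * gauss_fun z =
    f0 l + (v / 2 - (1 - l)) * (z * gauss_fun z) by rewrite /f0; ring.
apply: le_trans (ler_normD _ _) _.
have -> : 9 * v ^+ 2 = 8 * v ^+ 2 + v ^+ 2 * 1 by ring.
apply: lerD; first by apply: le_trans H _; nra.
rewrite normrM ler_pM ?normM_gauss_le1//.
(* Multiplying by 1 + l removes the square root and exhibits a factor v (1 - l) <= v^2; this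
   accounts for the ninth v^2 beside the 8 v^2 of the remainder. *)
have E2 : (v / 2 - (1 - l)) * (1 + l) = v * (1 - l) * (1 + 2 * l) / 2.
  have -> : (v / 2 - (1 - l)) * (1 + l) = v / 2 * (1 + l) - l ^+ 2 * v.
    by rewrite mulrBl E1.
  by field.
have h0 : 0 <= v * (1 - l) by rewrite mulr_ge0// subr_ge0.
have h1 : v * (1 - l) <= v ^+ 2 by rewrite expr2 ler_wpM2l.
rewrite ler_norml; apply/andP; split; nra.
Qed.

(* One step of the heat-equation argument: h is the rescaled increment, whose
   second moment is v / 2, and l the ratio of successive space scales. *)
Lemma erf0_heat_step z h v l : 0 <= v <= 1 -> 0 <= l -> l ^+ 2 * (1 + v) = 1 ->
  `|erf0 (z + h) - erf0 (l * z) - h * gauss_fun z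
     + (h ^+ 2 - v / 2) * (z * gauss_fun z)| <= 2 * `|h| ^+ 3 + 9 * v ^+ 2.
Proof.
move=> v01 l0 lv; have A := erf0_taylor z h; have B := erf0_dilation z v01 l0 lv.
rewrite -[X in `|X|](_ : (erf0 (z + h) - erf0 z - h * gauss_fun z + h ^+ 2 * z * gauss_fun z)
  - (erf0 (l * z) - erf0 z + v / 2 * z * gauss_fun z) = _); last by ring.
by apply: le_trans (ler_normB _ _) _; apply: lerD.
Qed.

Lemma erf0_lipschitz x y : `|erf0 y - erf0 x| <= `|y - x|.
Proof.
rewrite -[X in _ <= X]mul1r; apply: derive_lipschitz is_derive_erf0 _ => t _.
by rewrite ger0_norm ?gauss_fun_le1// gauss_fun_ge0.
Qed.

Lemma erf00 : erf0 0 = 0 :> R. Proof. by rewrite erf0.unlock subrr. Qed.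

Lemma erf0_sub_id x : `|erf0 x - x| <= 2 * `|x| ^+ 2.
Proof.
have d t : is_derive t (1 : R) (fun x => erf0 x - x) (gauss_fun t - 1).
  have ? := is_derive_erf0 t; exact: is_derive_eq.
have := @derive_lipschitz _ _ (2 * `|x|) 0 x d.
rewrite erf00 !subr0 -mulrA -expr2; apply => t; rewrite subr0 => tx.
have := @derive_lipschitz _ _ 2 0 t is_derive_gauss; rewrite subr0.
have -> : gauss_fun 0 = 1 :> R by rewrite /gauss_fun expr2 mul0r oppr0 expR0.
have G y : `|- 2 * y * gauss_fun y| <= 2.
  rewrite -mulrA normrM normrN (ger0_norm (_ : 0 <= 2))//.
  by rewrite -[X in _ <= X]mulr1 ler_wpM2l// normM_gauss_le1.
move=> /(_ (fun x _ => G x)) H; apply: le_trans H _; exact: ler_wpM2l.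
Qed.

Lemma continuous_erf0 : continuous (@erf0 R).
Proof.
by move=> t; apply/differentiable_continuous/derivable1_diffP; case: (is_derive_erf0 t).
Qed.

Lemma erf0_homo : {homo @erf0 R : x y / x <= y}.
Proof.
move=> x y xy; have cf := continuous_erf0.
have [c _ E] := MVT_segment xy (fun x _ => is_derive_erf0 x) (continuous_subspaceT cf).
by rewrite -subr_ge0 E mulr_ge0 ?gauss_fun_ge0// subr_ge0.
Qed.

(** Monotonicity and boundedness give some limit; the fundamental theorem on the half-line
    identifies it with half the Gaussian integral. *)
Lemma cvg_erf0 : @erf0 R x @[x --> +oo] --> Num.sqrt pi / 2.
Proof.
have cf := continuous_erf0.
have bd : has_ubound (range (@erf0 R)).
  exists (Num.sqrt pi) => _ [x _ <-]; rewrite erf0.unlock.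
  have h : \int[leb]_(t in `]-oo, x]) gauss_fun t <= Num.sqrt pi.
    rewrite -[X in _ <= X]/(fine (Num.sqrt pi)%:E) -integralT_gauss.
    rewrite /Rintegral fine_le//; first exact: integrable_fin_num (gauss_int _).
      by rewrite integralT_gauss.
    apply: ge0_subset_integral => //.
      by apply/measurable_EFinP; exact: measurable_gauss_fun.
    by move=> t _; rewrite lee_fin gauss_fun_ge0.
  have : 0 <= \int[leb]_(t in `]-oo, 0]) gauss_fun t.
    by apply: Rintegral_ge0 => t _; exact: gauss_fun_ge0.
  by move=> h0; rewrite lerBlDr (le_trans h)// lerDl.
have /cvg_ex[l El] : cvg (@erf0 R x @[x --> +oo]).
  apply/cvg_ex; eexists; apply: nondecreasing_cvgr => //; exact: erf0_homo.
have := @ge0_continuous_FTC2y R gauss_fun erf0 0 l _ _ El.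
rewrite integral0y_gauss erf00 sube0 => H.
suff [->] : (Num.sqrt pi / 2)%:E = l%:E by [].
apply: H.
- by move=> x _; exact: gauss_fun_ge0.
- by apply: continuous_subspaceT; exact: continuous_gauss_fun.
- by move=> x _; case: (is_derive_erf0 x).
- by have := cvg_at_right_filter (cf 0); rewrite erf00.
- by move=> x _; rewrite derive1E; case: (is_derive_erf0 x).
Qed.

Lemma erf0_le x : erf0 x <= Num.sqrt pi / 2.
Proof.
apply: (cvgr_to_ge cvg_erf0); near=> t; apply: erf0_homo; near: t.
by apply: nbhs_pinfty_ge; rewrite num_real.
Unshelve. all: end_near. Qed.

End error_function.
(** * Expectations of bounded variables and independence *)

HB.lock Definition Ex d (T : measurableType d) (R : realType)
  (P : probability T R) (f : T -> R) : R := \int[P]_w f w.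

Section bounded_expectation.
Context d (T : measurableType d) (R : realType) (P : probability T R).
Implicit Types f g : T -> R.

(** The bound holds at every point, not almost surely: the class is then closed under sums and
    products, and all its members are integrable. The final truncation makes it available for the
    given variables. *)
Definition bounded_rv f := measurable_fun setT f /\ exists C : R, forall w, `|f w| <= C.

Local Notation Ex := (Ex P).

Lemma bounded_rv_integrable f : bounded_rv f -> P.-integrable setT (EFin \o f).
Proof.
move=> [mf [C fC]]; apply: measurable_bounded_integrable => //.
  by rewrite [X in (X < _)%E](probability_setT P) ltry.
exists C; split; first exact: num_real.
by move=> x Cx w _; apply: le_trans (fC w) (ltW Cx).
Qed.

Lemma bounded_rv_cst (c : R) : bounded_rv (cst c).
Proof. by split=> //; exists `|c|. Qed.

Lemma bounded_rvD f g : bounded_rv f -> bounded_rv g -> bounded_rv (f \+ g).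
Proof.
move=> [mf [C fC]] [mg [D gD]]; split; first exact: measurable_funD.
by exists (C + D) => w; apply: le_trans (ler_normD _ _) _; apply: lerD.
Qed.

Lemma bounded_rvN f : bounded_rv f -> bounded_rv (\- f).
Proof.
move=> [mf [C fC]]; split; first exact: measurableT_comp.
by exists C => w; rewrite normrN.
Qed.

Lemma bounded_rvB f g : bounded_rv f -> bounded_rv g -> bounded_rv (f \- g).
Proof. by move=> bf bg; apply: bounded_rvD bf (bounded_rvN bg). Qed.

Lemma bounded_rvM f g : bounded_rv f -> bounded_rv g -> bounded_rv (f \* g).
Proof.
move=> [mf [C fC]] [mg [D gD]]; split; first exact: measurable_funM.
by exists (C * D) => w; rewrite normrM ler_pM.
Qed.

Lemma bounded_rvZ (c : R) f : bounded_rv f -> bounded_rv (fun w => c * f w).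
Proof. by move=> bf; apply: bounded_rvM (bounded_rv_cst c) bf. Qed.

Lemma bounded_rvX f n : bounded_rv f -> bounded_rv (fun w => f w ^+ n).
Proof.
move=> bf; elim: n => [|n ih]; first exact: bounded_rv_cst 1.
rewrite (_ : (fun _ => _) = f \* (fun w => f w ^+ n)); first exact: bounded_rvM.
by apply/funext => w; rewrite /= exprS.
Qed.

Lemma bounded_rv_norm f : bounded_rv f -> bounded_rv (fun w => `|f w|).
Proof.
move=> [mf [C fC]]; split; first exact: measurableT_comp.
by exists C => w; rewrite normr_id.
Qed.

Lemma bounded_rv_sum (I : Type) (s : seq I) (F : I -> T -> R) :
  (forall i, bounded_rv (F i)) -> bounded_rv (fun w => \sum_(i <- s) F i w).
Proof.
move=> bF; elim: s => [|i s ih].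
  rewrite (_ : (fun _ => _) = cst 0); first exact: bounded_rv_cst.
  by apply/funext => w; rewrite big_nil.
rewrite (_ : (fun _ => _) = F i \+ (fun w => \sum_(i <- s) F i w)).
  exact: bounded_rvD.
by apply/funext => w; rewrite big_cons.
Qed.

Lemma Ex_cst (c : R) : Ex (fun=> c) = c.
Proof. by rewrite Ex.unlock Rintegral_cst// [X in fine X](probability_setT P) mulr1. Qed.

Lemma ExD f g : bounded_rv f -> bounded_rv g ->
  Ex (fun w => f w + g w) = Ex f + Ex g.
Proof.
by move=> bf bg; rewrite Ex.unlock;
  apply: RintegralD => //; exact: bounded_rv_integrable.
Qed.

Lemma ExB f g : bounded_rv f -> bounded_rv g ->
  Ex (fun w => f w - g w) = Ex f - Ex g.
Proof.
by move=> bf bg; rewrite Ex.unlock;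
  apply: RintegralB => //; exact: bounded_rv_integrable.
Qed.

Lemma ExZ (c : R) f : bounded_rv f -> Ex (fun w => c * f w) = c * Ex f.
Proof.
by move=> bf; rewrite Ex.unlock;
  apply: RintegralZl => //; exact: bounded_rv_integrable.
Qed.

Lemma Ex_sum (I : Type) (s : seq I) (F : I -> T -> R) :
  (forall i, bounded_rv (F i)) ->
  Ex (fun w => \sum_(i <- s) F i w) = \sum_(i <- s) Ex (F i).
Proof.
move=> bF; elim: s => [|i s ih].
  by rewrite big_nil -[RHS](Ex_cst 0); congr Ex; apply/funext => w; rewrite big_nil.
rewrite big_cons -ih -ExD//; last exact: bounded_rv_sum.
by congr Ex; apply/funext => w; rewrite big_cons.
Qed.

Lemma le_Ex f g : bounded_rv f -> bounded_rv g -> (forall w, f w <= g w) ->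
  Ex f <= Ex g.
Proof.
by move=> bf bg fg; rewrite Ex.unlock;
  apply: le_Rintegral => //; exact: bounded_rv_integrable.
Qed.

Lemma Ex_ge0 f : (forall w, 0 <= f w) -> 0 <= Ex f.
Proof. by move=> f0; rewrite Ex.unlock; apply: Rintegral_ge0. Qed.

Lemma norm_Ex_le f : bounded_rv f -> `|Ex f| <= Ex (fun w => `|f w|).
Proof.
by move=> bf; rewrite Ex.unlock;
  apply: le_normr_Rintegral => //; exact: bounded_rv_integrable.
Qed.

Lemma EFin_Ex f : bounded_rv f -> (\int[P]_w (f w)%:E)%E = (Ex f)%:E.
Proof.
move=> bf; rewrite Ex.unlock /Rintegral fineK//.
by apply: integrable_fin_num => //; exact: bounded_rv_integrable.
Qed.

Lemma Ex_indic (A : set T) : measurable A -> Ex (\1_A) = fine (P A).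
Proof. by move=> mA; rewrite Ex.unlock /Rintegral integral_indic// setIT. Qed.

End bounded_expectation.

(** The notion [independent_RVs] for bare functions, so that truncated variables qualify without
    being packaged as random variables. *)
Definition independent_seq d (T : measurableType d) (R : realType)
    (P : probability T R) (X : nat -> T -> R) : Prop :=
  forall (J : {fset nat}) (B : nat -> set R),
    [set` J] `<=` [set i | (1 <= i)%N] ->
    (forall i, i \in J -> measurable (B i)) ->
    P (\bigcap_(i in [set` J]) (X i @^-1` B i))
      = (\prod_(i <- J) P (X i @^-1` B i))%E.

(** * Independence of a step from the past *)

Section independence.
Context d (T : measurableType d) (R : realType) (P : probability T R).
Variable X : nat -> T -> R.
Hypothesis mX : forall i, measurable_fun setT (X i).
Hypothesis indepX : independent_seq P X.

(** A pi-system generating the sigma-algebra of [X 1], ..., [X k], made of the rectangles on which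
    the independence hypothesis speaks directly. *)
Definition cylinders (k : nat) : set (set T) :=
  [set C | exists2 B : nat -> set R, (forall i, measurable (B i)) &
    C = \bigcap_(i in [set i | (1 <= i <= k)%N]) (X i @^-1` B i)].

Definition adapted (k : nat) (f : T -> R) :=
  @measurable_fun _ _ (g_sigma_algebraType (cylinders k)) R setT f.

Let mX' i (B : set R) : measurable B -> measurable (X i @^-1` B).
Proof. by move=> mB; rewrite -[X in measurable X]setTI; exact: mX. Qed.

Lemma cylinders_measurable k : cylinders k `<=` measurable.
Proof.
by move=> _ [B mB ->]; apply: bigcap_measurableType => i _; exact: mX'.
Qed.

Lemma sigma_cylinders_measurable k : <<s cylinders k >> `<=` measurable.
Proof.
by apply: smallest_sub (@cylinders_measurable k); exact: sigma_algebra_measurable.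
Qed.

Lemma cylinders_setI k : setI_closed (cylinders k).
Proof.
move=> _ _ [B mB ->] [C mC ->]; exists (fun i => B i `&` C i).
  by move=> i; exact: measurableI.
by rewrite -bigcapI.
Qed.

Lemma cylinders_setT k : cylinders k setT.
Proof.
exists (fun=> setT) => //; apply/seteqP; split => // w _ i _ //.
Qed.

Lemma indep_cylinder k C B : cylinders k C -> measurable B ->
  P (C `&` X k.+1 @^-1` B) = (P C * P (X k.+1 @^-1` B))%E.
Proof.
move=> [D mD ->] mB.
pose J := [fset i in iota 1 k]%fset.
have J1 i : (i \in J) = (1 <= i <= k)%N.
  by rewrite !inE /= mem_iota add1n ltnS.
have EJ : [set i | (1 <= i <= k)%N] = [set` J].
  by apply/seteqP; split => i /=; rewrite J1.
pose D' i := if i == k.+1 then B else D i.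
have mD' i : measurable (D' i) by rewrite /D'; case: ifP.
have kJ : k.+1 \notin J by rewrite J1 ltnn andbF.
have DD' i : i \in J -> D' i = D i.
  by rewrite /D'; case: eqP => // ->; rewrite (negbTE kJ).
have Dk : D' k.+1 = B by rewrite /D' eqxx.
have := @indepX (k.+1 |` J)%fset D' _ (fun i _ => mD' i).
rewrite big_fsetU1//= Dk.
rewrite (_ : \bigcap_(i in _) _ =
  \bigcap_(i in [set i | (1 <= i <= k)%N]) X i @^-1` D i `&` X k.+1 @^-1` B); last first.
  apply/seteqP; split => w.
    move=> H; split.
      move=> i /= ik; have iJ : i \in J by rewrite J1.
      by rewrite -(DD' _ iJ); apply: H; rewrite /= in_fset1U iJ orbT.
    by rewrite -Dk; apply: H; rewrite /= in_fset1U eqxx.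
  move=> [H1 H2] i /=; rewrite in_fset1U => /orP[/eqP ->|iJ]; first by rewrite Dk.
  by rewrite DD'//; apply: H1; rewrite /= -J1.
move=> -> //; last first.
  move=> i /=; rewrite in_fset1U => /orP[/eqP -> //|].
  by rewrite J1 => /andP[].
rewrite muleC; congr (_ * _)%E.
rewrite EJ indepX//.
- by rewrite big_seq [RHS]big_seq; apply: eq_bigr => i /DD' ->.
- by move=> i /=; rewrite J1 => /andP[].
Qed.

(** For fixed [B] both sides are finite measures in [E]; they agree on the pi-system of cylinders,
    hence on the sigma-algebra it generates. *)
Lemma indep_sigma_cylinders k E B : <<s cylinders k >> E -> measurable B ->
  P (E `&` X k.+1 @^-1` B) = (P E * P (X k.+1 @^-1` B))%E.
Proof.
move=> sE mB.
have fP : P (X k.+1 @^-1` B) \is a fin_num by apply: fin_num_measure; exact: mX'.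
have c0 : 0 <= fine (P (X k.+1 @^-1` B)) by rewrite fine_ge0.
pose m1 := mrestr P (mX' k.+1 mB).
pose m2 := mscale (NngNum c0) P.
rewrite -[LHS]/(m1 E).
rewrite [RHS]muleC -[X in (X * _)%E]fineK// -[RHS]/(m2 E).
apply: (@g_sigma_algebra_measure_unique _ _ _ (cylinders k) _ (fun=> setT)) => //.
- exact: cylinders_measurable.
- by move=> _; exact: cylinders_setT.
- by rewrite bigcup_const.
- exact: cylinders_setI.
- move=> A cA; rewrite [RHS](_ : _ = (fine (P (X k.+1 @^-1` B)))%:E * P A)%E//.
  by rewrite fineK// muleC; exact: indep_cylinder.
- move=> _; apply: (@le_lt_trans _ _ 1%E); last by rewrite ltry.
  by apply: probability_le1; apply: measurableI => //; exact: mX'.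
Qed.

Lemma adapted_measurable k f : adapted k f -> measurable_fun setT f.
Proof.
by move=> af mT B mB; apply: (@sigma_cylinders_measurable k); exact: af.
Qed.

Lemma adapted_X k i : (1 <= i <= k)%N -> adapted k (X i).
Proof.
move=> ik _ B mB; rewrite setTI; apply: sub_sigma_algebra.
exists (fun j => if j == i then B else setT); first by move=> j; case: ifP.
apply/seteqP; split => w /=.
  by move=> wB j _; case: eqP => // ->.
by move=> /(_ i ik)/=; rewrite eqxx.
Qed.

Lemma adaptedS k l f : (k <= l)%N -> adapted k f -> adapted l f.
Proof.
move=> kl af _ B mB; have := af measurableT B mB.
rewrite !setTI; apply: smallest_sub; first exact: smallest_sigma_algebra.
move=> _ [D mD ->]; apply: sub_sigma_algebra.
exists (fun j => if (j <= k)%N then D j else setT); first by move=> j; case: ifP.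
apply/seteqP; split => w /= H i /andP[i1 il].
  by case: ifP => // ik; apply: H => /=; rewrite i1.
by have := H i; rewrite /= il; apply; rewrite i1 (leq_trans il).
Qed.

Section pair.
Variables (k : nat) (Z : T -> R) (h : R -> R).
Hypothesis aZ : adapted k Z.
Hypothesis mh : measurable_fun setT h.
Let W := h \o X k.+1.

Let mZ : measurable_fun setT Z := adapted_measurable aZ.
Let mW : measurable_fun setT W := measurableT_comp mh (mX k.+1).

HB.instance Definition _ := isMeasurableFun.Build _ _ _ _ Z mZ.
HB.instance Definition _ := isMeasurableFun.Build _ _ _ _ W mW.

Lemma pair_law (A : set (R * R)) : measurable A ->
  (distribution P Z \x distribution P W)%E A = P [set w | A (Z w, W w)].
Proof.
move=> mA.
have mZW : measurable_fun setT (fun w => (Z w, W w)).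
  exact: measurable_fun_pair.
pose mm := isMeasurableFun.Build _ _ _ _ _ mZW.
pose ZW : {mfun T >-> (R * R)%type} :=
  MeasurableFun.Pack (MeasurableFun.Class mm).
rewrite (@product_measure_unique _ _ _ _ _ _ _ (distribution P ZW))//.
move=> B C mB mC; rewrite /distribution /pushforward/=.
apply: (indep_sigma_cylinders (k := k) (B := h @^-1` C)).
- by have := aZ measurableT mB; rewrite setTI.
- by rewrite -[X in measurable X]setTI; exact: mh.
Qed.

Hypothesis bZ : bounded_rv Z.
Hypothesis bW : bounded_rv W.

(** The expectation is moved to the joint law of the pair, which [pair_law] identifies with the
    product of the marginals, and Fubini applies there. *)
Lemma Ex_indep : Ex P (Z \* W) = Ex P Z * Ex P W.
Proof.
have mZW : measurable_fun setT (fun w => (Z w, W w)).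
  exact: measurable_fun_pair.
pose mm := isMeasurableFun.Build _ _ _ _ _ mZW.
pose ZW : {mfun T >-> (R * R)%type} :=
  MeasurableFun.Pack (MeasurableFun.Class mm).
pose f (p : R * R) : \bar R := (p.1 * p.2)%:E.
have mf : measurable_fun setT f.
  by apply/measurable_EFinP; apply: measurable_funM.
have iZW : P.-integrable setT (f \o ZW).
  exact: (bounded_rv_integrable P (bounded_rvM bZ bW)).
have E0 (g : R * R -> \bar R) :
    (\int[distribution P Z \x distribution P W]_p g p =
     \int[distribution P ZW]_p g p)%E.
  by apply: eq_measure_integral => A mA _; apply: pair_law.
have iD : (distribution P Z \x distribution P W)%E.-integrable setT f.
  apply/integrableP; split => //; rewrite E0 ge0_integral_distribution//.
    by have /integrableP[] := iZW.
  exact: measurableT_comp.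
have bZc : bounded_rv (fun w => Z w * Ex P W).
  by apply: (bounded_rvM bZ); exact: bounded_rv_cst.
apply: EFin_inj.
rewrite -EFin_Ex; last exact: bounded_rvM.
rewrite -[LHS]/(\int[P]_w (f \o ZW) w)%E -integral_distribution// -E0.
rewrite -integral12_prod_meas1//.
have E1 x : fubini_F (distribution P W) f x = (x * Ex P W)%:E.
  rewrite /fubini_F /f/=.
  rewrite (@integral_distribution _ _ _ _ _ P W (fun y => (x * y)%:E))//.
  - by rewrite -ExZ// EFin_Ex//; exact: bounded_rvZ.
  - by apply/measurable_EFinP; exact: measurable_funM.
  - exact: (bounded_rv_integrable P (bounded_rvZ x bW)).
under eq_integral do rewrite E1.
rewrite (@integral_distribution _ _ _ _ _ P Z (fun x => (x * Ex P W)%:E))//.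
- rewrite (@EFin_Ex _ _ _ _ (fun w => Z w * Ex P W)); last exact: bZc.
  by congr EFin; rewrite mulrC -ExZ//; congr Ex; apply/funext => w; rewrite mulrC.
- by apply/measurable_EFinP; exact: measurable_funM.
- exact: (bounded_rv_integrable P bZc).
Qed.

End pair.

(** Under the product law, each section at a fixed value of [Z] prescribes a single value of
    [X k.+1], hence is null. *)
Lemma indep_noatom k (Z : T -> R) (a c : R) : adapted k Z ->
  a != 0 -> (forall x, P [set w | X k.+1 w = x] = 0%E) ->
  P [set w | Z w + a * X k.+1 w = c] = 0%E.
Proof.
move=> aZ a0 noatom.
have mh : measurable_fun setT (@idfun R) := @measurable_id _ _ _.
pose A : set (R * R) := [set p | p.1 + a * p.2 = c].
have mA : measurable A.
  rewrite -[A]setTI.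
  have mf : measurable_fun setT (fun p : R * R => p.1 + a * p.2); last first.
    by have := mf measurableT _ (measurable_set1 c).
  by apply: measurable_funD => //; apply: measurable_funM.
rewrite -[LHS](pair_law aZ mh mA) /product_measure1/=.
apply: integral0_eq => x _ /=; rewrite /distribution /pushforward/=.
rewrite -[RHS](noatom ((c - x) / a)); congr (P _).
apply/seteqP; split => w /=.
  by rewrite /xsection/= inE /A/= => <-; field.
by rewrite /xsection/= inE /A/= => ->; field.
Qed.
End independence.
(** * Survival estimates for one row *)

(* With rho = sigma / 128 in alive_recursion the first error term is at most 1/8;
   the second one is at most 1/8 as soon as sigma >= 2432 * 128^3 * M. *)
HB.lock Definition survival_const {R : realType} : R := 2432 * 128 ^+ 3.

HB.lock Definition walk (T : Type) (R : realType) (X : nat -> T -> R)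
  (u : nat -> R) (k : nat) (w : T) : R := \sum_(1 <= i < k.+1) u i * X i w.

(* The indicator of {tau > k}. *)
HB.lock Definition alive (T : Type) (R : realType) (X : nat -> T -> R)
  (u G : nat -> R) (k : nat) (w : T) : R :=
  \prod_(1 <= j < k.+1) \1_`]G j, +oo[ (walk X u j w).

HB.lock Definition step_var d (T : measurableType d) (R : realType)
  (P : probability T R) (X : nat -> T -> R) (u : nat -> R) (k : nat) : R :=
  u k ^+ 2 * Ex P (fun w => X k w ^+ 2).

HB.lock Definition walk_var d (T : measurableType d) (R : realType)
  (P : probability T R) (X : nat -> T -> R) (u : nat -> R) (k : nat) : R :=
  \sum_(1 <= i < k.+1) step_var P X u i.

(* sqrt (2 t) for the regularised remaining time t = V_n - V_k + rho^2 / 2. *)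
HB.lock Definition horizon d (T : measurableType d) (R : realType)
  (P : probability T R) (X : nat -> T -> R) (u : nat -> R) (n : nat) (rho : R)
  (k : nat) : R :=
  Num.sqrt (2 * (walk_var P X u n - walk_var P X u k) + rho ^+ 2).

Section row.
Context d (T : measurableType d) (R : realType) (P : probability T R).
Variable X : nat -> T -> R.
Hypothesis mX : forall i, measurable_fun setT (X i).
Hypothesis indepX : independent_seq P X.
Hypothesis bX : forall i, (1 <= i)%N -> bounded_rv (X i).
Hypothesis X0 : forall i, (1 <= i)%N -> Ex P (X i) = 0.
Variables (u G : nat -> R) (M : R).
Hypothesis M0 : 0 < M.
Hypothesis uM : forall i w, (1 <= i)%N -> `|u i * X i w| <= M.
Hypothesis GM : forall i, (1 <= i)%N -> `|G i| <= M.

Local Notation E := (Ex P).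
Local Notation adapted := (adapted X).

Local Notation S := (walk X u).
Local Notation s := (step_var P X u).
Local Notation V := (walk_var P X u).
Local Notation a := (alive X u G).
Local Notation p := (fun k => E (a k)).

(** * The walk and its survival indicator *)

Lemma walk0 w : S 0 w = 0. Proof. by rewrite walk.unlock big_geq. Qed.

Lemma walkS k w : S k.+1 w = S k w + u k.+1 * X k.+1 w.
Proof. by rewrite walk.unlock big_nat_recr. Qed.

Lemma walk_var0 : V 0 = 0. Proof. by rewrite walk_var.unlock big_geq. Qed.

Lemma walk_varS k : V k.+1 = V k + s k.+1.
Proof. by rewrite walk_var.unlock big_nat_recr. Qed.

Lemma alive0 w : a 0 w = 1. Proof. by rewrite alive.unlock big_geq. Qed.

Lemma aliveS k w : a k.+1 w = a k w * \1_`]G k.+1, +oo[ (S k.+1 w).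
Proof. by rewrite alive.unlock big_nat_recr. Qed.

Lemma indic_gt (g x : R) : \1_`]g, +oo[ x = (g < x)%R%:R :> R.
Proof.
rewrite indicE; congr (nat_of_bool _)%:R.
by apply/idP/idP; rewrite inE/= in_itv/= andbT.
Qed.

Lemma alive01 k w : a k w = 0 \/ a k w = 1.
Proof.
elim: k => [|k ih]; first by right; rewrite alive0.
rewrite aliveS indic_gt; case: ih => ->; first by left; rewrite mul0r.
by case: (_ < _); [right; rewrite mulr1|left; rewrite mulr0].
Qed.

Lemma alive_ge0 k w : 0 <= a k w. Proof. by case: (alive01 k w) => ->. Qed.
Lemma alive_le1 k w : a k w <= 1. Proof. by case: (alive01 k w) => ->. Qed.

Lemma aliveS_le k w : a k.+1 w <= a k w.
Proof.
rewrite aliveS indic_gt ler_piMr ?alive_ge0//; case: (_ < _) => //; exact: ler01.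
Qed.

Lemma alive_le m n w : (m <= n)%N -> a n w <= a m w.
Proof.
elim: n => [|n ih]; first by rewrite leqn0 => /eqP ->.
rewrite leq_eqVlt => /predU1P[-> //|mn]; apply: le_trans (aliveS_le n w) (ih mn).
Qed.

Lemma alive_walk k w : a k w = 1 -> - M <= S k w.
Proof.
case: k => [|k]; first by rewrite walk0 oppr_le0 (ltW M0).
rewrite aliveS indic_gt => ak; have : G k.+1 < S k.+1 w.
  by move: ak; case: (_ < _) => //; rewrite mulr0 => /esym/eqP; rewrite oner_eq0.
by have /(_ isT) := @GM k.+1; rewrite ler_norml => /andP[/le_trans + _] /ltW; exact.
Qed.

(** The difference is the indicator of {tau = k + 1}. On that event the walk was at least -M one
    step before, moves by at most M, and ends below a boundary value that is at most M. *)
Lemma killed_walk k w : a k w - a k.+1 w = 0 \/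
  a k w - a k.+1 w = 1 /\ `|S k.+1 w| <= 2 * M.
Proof.
rewrite aliveS indic_gt; case: ltP => h; first by left; rewrite mulr1 subrr.
rewrite mulr0 subr0; case: (alive01 k w) => ak; first by left.
right; split => //; have := alive_walk ak.
have := @uM k.+1 w isT; have /(_ isT) := @GM k.+1.
rewrite (walkS k) in h *; rewrite !ler_norml.
by move=> /andP[? ?] /andP[? ?] ?; apply/andP; split; lra.
Qed.

Lemma adapted_walk k j : (j <= k)%N -> adapted k (S j).
Proof.
elim: j => [|j ih] jk.
  rewrite (_ : S 0 = cst 0); last by apply/funext => w; rewrite walk0.
  exact: measurable_cst.
rewrite (_ : S _ = fun w => S j w + u j.+1 * X j.+1 w); last first.
  by apply/funext => w; rewrite walkS.
apply: measurable_funD; first exact: ih (ltnW jk).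
by apply: measurable_funM; [exact: measurable_cst|exact: adapted_X].
Qed.

Lemma adapted_alive k j : (j <= k)%N -> adapted k (a j).
Proof.
elim: j => [|j ih] jk.
  rewrite (_ : a 0 = cst 1); last by apply/funext => w; rewrite alive0.
  exact: measurable_cst.
rewrite (_ : a _ = fun w => a j w * \1_`]G j.+1, +oo[ (S j.+1 w)); last first.
  by apply/funext => w; rewrite aliveS.
apply: measurable_funM; first exact: ih (ltnW jk).
apply: (@measurableT_comp _ _ _ _ _ _ (\1_`]G j.+1, +oo[ : R -> R)).
  exact: measurable_indic.
exact: adapted_walk.
Qed.

Lemma bounded_walk k : bounded_rv (S k).
Proof.
elim: k => [|k ih].
  rewrite (_ : S 0 = cst 0); last by apply/funext => w; rewrite walk0.
  exact: bounded_rv_cst.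
rewrite (_ : S _ = S k \+ (fun w => u k.+1 * X k.+1 w)); last first.
  by apply/funext => w; rewrite walkS.
by apply: bounded_rvD => //; apply: bounded_rvZ; exact: bX.
Qed.

Lemma bounded_alive k : bounded_rv (a k).
Proof.
split; first exact: (adapted_measurable mX (adapted_alive (leqnn k))).
by exists 1 => w; rewrite ger0_norm ?alive_le1// alive_ge0.
Qed.

Lemma bounded_rv_lip (f : R -> R) (g : T -> R) :
  continuous f -> (forall x, `|f x| <= `|x| + `|f 0|) -> bounded_rv g ->
  bounded_rv (fun w => f (g w)).
Proof.
move=> cf f1 [mg [C gC]]; split.
  by apply: measurableT_comp => //; exact: continuous_measurable_fun.
by exists (C + `|f 0|) => w; apply: le_trans (f1 _) _; rewrite lerD2r.
Qed.

(** This and [Ex_step2] are the conditional mean and variance of a step given the past, tested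
    against bounded past weights. *)
Lemma Ex_step1 k Z : adapted k Z -> bounded_rv Z ->
  E (fun w => Z w * (u k.+1 * X k.+1 w)) = 0.
Proof.
move=> aZ bZ.
have mh : measurable_fun setT (fun x : R => u k.+1 * x) by apply: measurable_funM.
have bW : bounded_rv (fun w => u k.+1 * X k.+1 w) by apply: bounded_rvZ; exact: bX.
rewrite -[LHS]/(E (Z \* ((fun x => u k.+1 * x) \o X k.+1))).
by rewrite (Ex_indep mX indepX aZ mh bZ bW) [X in _ * X]ExZ ?X0 ?mulr0 ?mulr0//; exact: bX.
Qed.

Lemma Ex_step2 k Z : adapted k Z -> bounded_rv Z ->
  E (fun w => Z w * (u k.+1 * X k.+1 w) ^+ 2) = E Z * s k.+1.
Proof.
move=> aZ bZ.
have mh : measurable_fun setT (fun x : R => (u k.+1 * x) ^+ 2).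
  by apply: measurable_funX; apply: measurable_funM.
have bW : bounded_rv (fun w => (u k.+1 * X k.+1 w) ^+ 2).
  by apply: bounded_rvX; apply: bounded_rvZ; exact: bX.
rewrite -[LHS]/(E (Z \* ((fun x => (u k.+1 * x) ^+ 2) \o X k.+1))).
rewrite (Ex_indep mX indepX aZ mh bZ bW); congr (_ * _).
rewrite step_var.unlock -ExZ; last by apply: bounded_rvX; exact: bX.
by congr Ex; apply/funext => w; rewrite /= exprMn.
Qed.

Lemma step_var_ge0 k : 0 <= s k.
Proof. by rewrite step_var.unlock mulr_ge0 ?sqr_ge0// Ex_ge0// => w; exact: sqr_ge0. Qed.

Lemma step_var_le k : s k.+1 <= M ^+ 2.
Proof.
rewrite step_var.unlock -ExZ; last by apply: bounded_rvX; exact: bX.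
rewrite -[leRHS](Ex_cst P); apply: le_Ex.
- by apply: bounded_rvZ; apply: bounded_rvX; exact: bX.
- exact: bounded_rv_cst.
move=> w; rewrite -exprMn -real_normK ?num_real//.
by rewrite lerXn2r ?nnegrE// ?(ltW M0)// uM.
Qed.

Lemma walk_var_le m n : (m <= n)%N -> V m <= V n.
Proof.
elim: n => [|n ih]; first by rewrite leqn0 => /eqP ->.
rewrite leq_eqVlt => /predU1P[-> //|mn]; apply: le_trans (ih mn) _.
by rewrite walk_varS lerDl step_var_ge0.
Qed.

Lemma walk_var_ge0 n : 0 <= V n.
Proof. by rewrite -walk_var0 walk_var_le. Qed.

(** * Heat-equation estimates along the walk *)

Lemma bounded_rv_erf0 (g : T -> R) : bounded_rv g -> bounded_rv (fun w => erf0 (g w)).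
Proof.
apply: bounded_rv_lip (@continuous_erf0 R) _ => x.
by have := erf0_lipschitz 0 x; rewrite erf00 !subr0 normr0 addr0.
Qed.

Lemma bounded_rv_gauss (g : T -> R) : measurable_fun setT g ->
  bounded_rv (fun w => gauss_fun (g w)).
Proof.
move=> mg; split; first by apply: measurableT_comp => //; exact: measurable_gauss_fun.
by exists 1 => w; rewrite ger0_norm ?gauss_fun_ge0// gauss_fun_le1.
Qed.

(** In [erf0_heat_step] the linear term vanishes by the mean-zero property, and the quadratic one
    because the rescaled increment has second moment v / 2. Shift and weight are left free: survival
    uses c = 0 and the indicator [alive], anticoncentration uses c = 2 rho and -2 rho with a frozen
    weight. *)
Lemma heat_step k (b : T -> R) (c r r' : R) :
  adapted k b -> (forall w, 0 <= b w <= 1) -> 2 * M <= r' -> 0 < r ->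
  r ^+ 2 = r' ^+ 2 + 2 * s k.+1 ->
  `|E (fun w => b w * erf0 ((S k.+1 w + c) / r'))
    - E (fun w => b w * erf0 ((S k w + c) / r))|
  <= 38 * M / r' ^+ 3 * s k.+1 * E b.
Proof.
move=> ab b01 Mr r0 rr'.
have r'0 : 0 < r' by have := M0; lra.
have bb : bounded_rv b.
  split; first exact: (adapted_measurable mX ab).
  by exists 1 => w; have /andP[b0 b1] := b01 w; rewrite ger0_norm.
set v := 2 * s k.+1 / r' ^+ 2.
have sg0 := step_var_ge0 k.+1; have sM := step_var_le k.
have v01 : 0 <= v <= 1.
  apply/andP; split; first by rewrite divr_ge0 ?sqr_ge0// mulr_ge0.
  by rewrite ler_pdivrMr ?exprn_gt0// mul1r; have := M0; nra.
pose l := r' / r.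
have l0 : 0 <= l by rewrite divr_ge0// ltW.
have lv : l ^+ 2 * (1 + v) = 1.
  rewrite /l /v expr_div_n rr'; field.
  by rewrite -rr' !gt_eqF ?exprn_gt0.
pose z w := (S k w + c) / r'.
pose x w := u k.+1 * X k.+1 w.
have az : adapted k z.
  apply: measurable_funM; last exact: measurable_cst.
  by apply: measurable_funD; [exact: adapted_walk|exact: measurable_cst].
have bz : bounded_rv z.
  by apply: (bounded_rvM (bounded_rvD (bounded_walk k) _)); exact: bounded_rv_cst.
have mz := bz.1.
have bx : bounded_rv x by apply: bounded_rvZ; exact: bX.
pose Z1 w := b w * gauss_fun (z w) / r'.
pose Z2 w := b w * (z w * gauss_fun (z w)) / r' ^+ 2.
have mg : measurable_fun setT (@gauss_fun R) := measurable_gauss_fun.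
have agz : adapted k (fun w => gauss_fun (z w)) by exact: measurableT_comp.
have aZ1 : adapted k Z1.
  by apply: measurable_funM; [exact: measurable_funM|exact: measurable_cst].
have aZ2 : adapted k Z2.
  apply: measurable_funM; last exact: measurable_cst.
  by apply: measurable_funM => //; exact: measurable_funM.
have bgz := bounded_rv_gauss mz.
have bZ1 : bounded_rv Z1.
  by apply: (bounded_rvM (bounded_rvM bb bgz)); exact: bounded_rv_cst.
have bZ2 : bounded_rv Z2.
  by apply: (bounded_rvM (bounded_rvM bb (bounded_rvM bz bgz))); exact: bounded_rv_cst.
pose D w := erf0 (z w + x w / r') - erf0 (l * z w) - x w / r' * gauss_fun (z w)
     + ((x w / r') ^+ 2 - v / 2) * (z w * gauss_fun (z w)).
have bF : bounded_rv (fun w => b w * erf0 ((S k.+1 w + c) / r')).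
  apply: (bounded_rvM bb); apply: bounded_rv_erf0.
  by apply: (bounded_rvM (bounded_rvD (bounded_walk _) _)); exact: bounded_rv_cst.
have bF' : bounded_rv (fun w => b w * erf0 ((S k w + c) / r)).
  apply: (bounded_rvM bb); apply: bounded_rv_erf0.
  by apply: (bounded_rvM (bounded_rvD (bounded_walk _) _)); exact: bounded_rv_cst.
have bZ1x : bounded_rv (fun w => Z1 w * x w) by exact: bounded_rvM.
have bZ2x : bounded_rv (fun w => Z2 w * x w ^+ 2).
  by apply: bounded_rvM => //; exact: bounded_rvX.
have bZ2s : bounded_rv (fun w => s k.+1 * Z2 w) by exact: bounded_rvZ.
have bd1 := bounded_rvB (bounded_rvB bF bF') bZ1x.
have bd2 := bounded_rvB bZ2x bZ2s.
have bD : (fun w => b w * D w) =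
  (fun w => (b w * erf0 ((S k.+1 w + c) / r') - b w * erf0 ((S k w + c) / r))
     - Z1 w * x w + (Z2 w * x w ^+ 2 - s k.+1 * Z2 w)).
  apply/funext => w.
  have E1 : (S k.+1 w + c) / r' = z w + x w / r' by rewrite walkS /z /x; ring.
  have E2 : (S k w + c) / r = l * z w by rewrite /l /z; field; rewrite !gt_eqF.
  rewrite E1 E2 /D /Z1 /Z2 /v; field.
  by rewrite gt_eqF.
have ED : E (fun w => b w * D w) =
    E (fun w => b w * erf0 ((S k.+1 w + c) / r'))
    - E (fun w => b w * erf0 ((S k w + c) / r)).
  rewrite bD ExD; [|exact: bd1|exact: bd2].
  rewrite ExB; [|exact: (bounded_rvB bF bF')|by []].
  rewrite ExB// ExB// (Ex_step1 aZ1 bZ1) (Ex_step2 aZ2 bZ2) ExZ//.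
  by rewrite subr0 [s _ * _]mulrC subrr addr0.
have bbD : bounded_rv (fun w => b w * D w).
  by rewrite bD; exact: (bounded_rvD bd1 bd2).
rewrite -ED; apply: le_trans (norm_Ex_le P bbD) _.
(* The constant is 38 = 2 + 36: one factor of the cubed increment is bounded by M, and 9 v^2 is 36
   s^2 / r'^4 with s <= M^2 <= M r'. *)
pose c1 := 2 * M / r' ^+ 3; pose c2 := 9 * v ^+ 2.
have bbx : bounded_rv (fun w => b w * x w ^+ 2).
  by apply: bounded_rvM => //; exact: bounded_rvX.
apply: (@le_trans _ _ (E (fun w => c1 * (b w * x w ^+ 2) + c2 * b w))).
  apply: le_Ex; first exact: bounded_rv_norm.
    by apply: bounded_rvD; exact: bounded_rvZ.
  move=> w; have /andP[b0 b1] := b01 w.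
  rewrite normrM (ger0_norm b0).
  apply: (le_trans (ler_wpM2l b0 (erf0_heat_step (z w) (x w / r') v01 l0 lv))).
  rewrite -/c2 mulrDr [b w * c2]mulrC lerD2r [leRHS]mulrCA; apply: ler_wpM2l => //.
  have -> : 2 * `|x w / r'| ^+ 3 = 2 * `|x w| / r' ^+ 3 * x w ^+ 2.
    rewrite normrM normfV (gtr0_norm r'0) -(real_normK (num_real (x w))).
    by field; rewrite gt_eqF.
  rewrite ler_wpM2r ?sqr_ge0// /c1 ler_wpM2r ?invr_ge0 ?exprn_ge0 ?(ltW r'0)//.
  by rewrite ler_wpM2l// uM.
rewrite ExD; [|exact: bounded_rvZ|exact: bounded_rvZ].
rewrite ExZ// ExZ// (Ex_step2 ab bb).
have Eb0 : 0 <= E b by apply: Ex_ge0 => w; case/andP: (b01 w).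
rewrite [leLHS](_ : _ = (c1 * s k.+1 + c2) * E b); last by ring.
apply: ler_wpM2r => //.
rewrite [leRHS](_ : _ = c1 * s k.+1 + 36 * M / r' ^+ 3 * s k.+1); last first.
  by rewrite /c1; field; rewrite gt_eqF.
rewrite lerD2l /c2 /v.
rewrite [leLHS](_ : _ = (36 * s k.+1 / r') / r' ^+ 3 * s k.+1); last first.
  by field; rewrite gt_eqF.
rewrite ler_wpM2r// ler_wpM2r ?invr_ge0 ?exprn_ge0 ?(ltW r'0)//.
rewrite ler_pdivrMr// -mulrA ler_wpM2l//; have := M0; nra.
Qed.

Local Notation horizon := (horizon P X u).

Lemma horizon_sqr n rho k : (k <= n)%N ->
  horizon n rho k ^+ 2 = 2 * (V n - V k) + rho ^+ 2.
Proof.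
move=> kn; rewrite horizon.unlock sqr_sqrtr// addr_ge0 ?sqr_ge0// mulr_ge0// subr_ge0.
exact: walk_var_le.
Qed.

Lemma horizon_last n rho : 0 <= rho -> horizon n rho n = rho.
Proof. by move=> r0; rewrite horizon.unlock subrr mulr0 add0r sqrtr_sqr ger0_norm. Qed.

Lemma horizon_ge n rho k : (k <= n)%N -> 0 <= rho -> rho <= horizon n rho k.
Proof.
move=> kn r0; rewrite horizon.unlock -{1}(ger0_norm r0) -sqrtr_sqr ler_wsqrtr// lerDr.
by rewrite mulr_ge0// subr_ge0 walk_var_le.
Qed.

Lemma bounded_rv_erf0_walk k (c r : R) :
  bounded_rv (fun w => erf0 ((S k w + c) / r)).
Proof.
apply: bounded_rv_erf0.
by apply: (bounded_rvM (bounded_rvD (bounded_walk _) _)); exact: bounded_rv_cst.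
Qed.

(** Each increment of E[b_k N_k] splits into the motion under the old weight, estimated by
    [heat_step], and the loss of weight at the new position, which is kept exactly. The horizon
    never drops below [rho], whence the uniform factor. *)
Lemma heat_telescope (b : nat -> T -> R) (c rho : R) m n : (m <= n)%N ->
  (forall k, (m <= k)%N -> adapted k (b k)) ->
  (forall k w, 0 <= b k w <= 1) -> 2 * M <= rho ->
  `|E (fun w => b n w * erf0 ((S n w + c) / rho))
    - E (fun w => b m w * erf0 ((S m w + c) / horizon n rho m))
    + \sum_(m <= k < n) E (fun w => (b k w - b k.+1 w) *
        erf0 ((S k.+1 w + c) / horizon n rho k.+1))|
  <= 38 * M / rho ^+ 3 * \sum_(m <= k < n) s k.+1 * E (b k).
Proof.
move=> mn ab b01 Mr.
have r0 : 0 < rho by have := M0; lra.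
pose N k w := erf0 ((S k w + c) / horizon n rho k).
have bN k : bounded_rv (N k) by exact: bounded_rv_erf0_walk.
have bb k : (m <= k)%N -> bounded_rv (b k).
  move=> mk; split; first exact: (adapted_measurable mX (ab _ mk)).
  by exists 1 => w; have /andP[b0 b1] := b01 k w; rewrite ger0_norm.
pose F k := E (fun w => b k w * N k w).
have -> : E (fun w => b n w * erf0 ((S n w + c) / rho)) = F n.
  by rewrite /F /N horizon_last// ltW.
rewrite -[X in _ - X]/(F m) -(telescope_sumr F mn) -big_split/=.
apply: le_trans (ler_norm_sum _ _ _) _.
rewrite mulr_sumr; apply: ler_sum_nat => k /andP[mk kn].
have mk1 : (m <= k.+1)%N by exact: leqW.
have bbN := bounded_rvM (bb _ mk) (bN k.+1).
have bbN1 := bounded_rvM (bb _ mk1) (bN k.+1).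
rewrite [X in _ + X](_ : _ = E (fun w => b k w * N k.+1 w) - F k.+1); last first.
  rewrite /F -ExB//; congr Ex; apply/funext => w.
  by rewrite -/(N k.+1 w) /= mulrBl.
rewrite addrC addrA subrK.
have hr : rho <= horizon n rho k.+1 by rewrite horizon_ge// ltW.
apply: le_trans (@heat_step k (b k) c (horizon n rho k) (horizon n rho k.+1)
  _ _ _ _ _) _ => //.
- exact: ab.
- exact: le_trans Mr hr.
- by rewrite (lt_le_trans r0)// horizon_ge// ?ltW// ltnW.
- by rewrite !horizon_sqr ?(ltnW kn)// walk_varS; ring.
rewrite mulrA ler_wpM2r//; first by apply: Ex_ge0 => w; case/andP: (b01 k w).
rewrite ler_wpM2r ?step_var_ge0// ler_wpM2l ?mulr_ge0 ?(ltW M0)//.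
by rewrite lef_pV2 ?posrE ?exprn_gt0// ?lerXn2r ?nnegrE ?(ltW r0)//
  ?(le_trans (ltW r0))// (lt_le_trans r0).
Qed.

Lemma alive_telescope n rho : 2 * M <= rho ->
  `|E (fun w => a n w * erf0 (S n w / rho))
    + \sum_(0 <= k < n) E (fun w => (a k w - a k.+1 w) *
        erf0 (S k.+1 w / horizon n rho k.+1))|
  <= 38 * M / rho ^+ 3 * \sum_(0 <= k < n) s k.+1 * p k.
Proof.
move=> Mr.
have := @heat_telescope a 0 rho 0 n (leq0n n) (fun k _ => adapted_alive (leqnn k))
  (fun k w => _) Mr.
(* The walk starts at the zero of [erf0], so the final term is balanced by the killed terms
   alone. *)
have -> : E (fun w => a 0 w * erf0 ((S 0 w + 0) / horizon n rho 0)) = 0.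
  rewrite -[RHS](Ex_cst P); congr Ex; apply/funext => w.
  by rewrite walk0 addr0 mul0r erf00 mulr0.
rewrite subr0.
under eq_bigr do under eq_fun do rewrite addr0.
under eq_fun do rewrite addr0.
by apply=> k w; rewrite alive_ge0 alive_le1.
Qed.

Lemma indic_window (x rho : R) : 0 < rho ->
  \1_`[- rho, rho] x <=
  4 * (erf0 ((x + 2 * rho) / rho) - erf0 ((x + - (2 * rho)) / rho)).
Proof.
move=> r0; rewrite indicE.
have [|_] := boolP (x \in _); last first.
  rewrite mulr_ge0// subr_ge0 erf0_homo// ler_pM2r ?invr_gt0//; lra.
rewrite inE/= in_itv/= => /andP[x1 x2].
(* In the window the two arguments are at least 1 and at most -1. Linearising at 1/4 and -1/4 leaves
   a margin 1/8 on each side, so the difference is at least 1/4, whence the factor 4. *)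
have H (y : R) : 1 <= y -> 1 / 8 <= erf0 y.
  move=> y1; have : `|erf0 (1 / 4 : R) - 1 / 4| <= 1 / 8.
    apply: le_trans (erf0_sub_id _) _.
    rewrite ger0_norm//; lra.
  rewrite ler_norml => /andP[h _].
  have : erf0 (1 / 4) <= erf0 y by apply: erf0_homo; lra.
  lra.
have H' (y : R) : y <= -1 -> erf0 y <= - 1 / 8.
  move=> y1; have : `|erf0 (- 1 / 4 : R) - - 1 / 4| <= 1 / 8.
    apply: le_trans (erf0_sub_id _) _.
    rewrite ler0_norm; lra.
  rewrite ler_norml => /andP[_ h].
  have : erf0 y <= erf0 (- 1 / 4) by apply: erf0_homo; lra.
  lra.
have h1 : 1 / 8 <= erf0 ((x + 2 * rho) / rho).
  by apply: H; rewrite ler_pdivlMr// mul1r; lra.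
have h2 : erf0 ((x + - (2 * rho)) / rho) <= - 1 / 8.
  by apply: H'; rewrite ler_pdivrMr//; lra.
rewrite /=; lra.
Qed.

Lemma bounded_rv_window k rho :
  bounded_rv (fun w => \1_`[- rho, rho] (S k w) : R).
Proof.
split; last first.
  by exists 1 => w; rewrite indicE; case: (_ \in _); rewrite ?normr1 ?normr0.
apply: (@measurableT_comp _ _ _ _ _ _ (\1_`[- rho, rho] : R -> R)).
  exact: measurable_indic.
exact: (bounded_walk k).1.
Qed.

(* F(x + 2 rho, t) - F(x - 2 rho, t) dominates the window |x| <= rho at the final
   time and is O(rho / sqrt t) earlier, erf0 being Lipschitz. *)
Lemma anticoncentration (b : T -> R) rho m n : (m <= n)%N ->
  adapted m b -> (forall w, 0 <= b w <= 1) -> 2 * M <= rho ->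
  E (fun w => b w * \1_`[- rho, rho] (S n w)) <=
  E b * (16 * rho / horizon n rho m + 304 * M * (V n - V m) / rho ^+ 3).
Proof.
move=> mn ab b01 Mr.
have r0 : 0 < rho by have := M0; lra.
have h0 : 0 < horizon n rho m by rewrite (lt_le_trans r0)// horizon_ge// ltW.
have bb : bounded_rv b.
  split; first exact: (adapted_measurable mX ab).
  by exists 1 => w; have /andP[b0 b1] := b01 w; rewrite ger0_norm.
have Eb0 : 0 <= E b by apply: Ex_ge0 => w; case/andP: (b01 w).
pose A c := E (fun w => b w * erf0 ((S n w + c) / rho)).
pose B c := E (fun w => b w * erf0 ((S m w + c) / horizon n rho m)).
have bA c := bounded_rvM bb (bounded_rv_erf0_walk n c rho).
have bB c := bounded_rvM bb (bounded_rv_erf0_walk m c (horizon n rho m)).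
pose err := 38 * M / rho ^+ 3 * ((V n - V m) * E b).
have AB c : `|A c - B c| <= err.
  have := @heat_telescope (fun=> b) c rho m n mn _ (fun=> b01) Mr.
  rewrite big1 ?addr0; last first.
    move=> k _; rewrite -[RHS](Ex_cst P); congr Ex; apply/funext => w.
    by rewrite subrr mul0r.
  rewrite -mulr_suml.
  have -> : \sum_(m <= k < n) s k.+1 = V n - V m.
    rewrite -(telescope_sumr V mn); apply: eq_bigr => k _.
    by rewrite walk_varS addrC addKr.
  apply => k mk; exact: adaptedS mk ab.
have AB1 := AB (2 * rho); have AB2 := AB (- (2 * rho)).
have BB : B (2 * rho) - B (- (2 * rho)) <= 4 * rho / horizon n rho m * E b.
  rewrite /B -ExB; [|exact: bB|exact: bB].
  rewrite -ExZ//; apply: le_Ex; first exact: (bounded_rvB (bB _) (bB _)).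
    exact: bounded_rvZ.
  move=> w; have /andP[b0 b1] := b01 w.
  rewrite -mulrBr mulrC ler_wpM2r//.
  apply: le_trans (ler_norm _) _; apply: le_trans (erf0_lipschitz _ _) _.
  rewrite -mulrBl normrM ger0_norm; last by lra.
  rewrite (gtr0_norm (_ : 0 < (horizon n rho m)^-1)) ?invr_gt0//.
  rewrite ler_wpM2r ?invr_ge0 ?(ltW h0)//.
  rewrite [leLHS](_ : _ = 4 * rho)//; ring.
have : E (fun w => b w * \1_`[- rho, rho] (S n w)) <= 4 * (A (2 * rho) - A (- (2 * rho))).
  have bAB := bounded_rvB (bA (2 * rho)) (bA (- (2 * rho))).
  rewrite /A -ExB; [|exact: bA|exact: bA].
  rewrite -ExZ; last exact: bAB.
  apply: le_Ex; last first.
  - move=> w; have /andP[b0 b1] := b01 w.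
    by rewrite -mulrBr mulrCA ler_wpM2l// indic_window.
  - exact: bounded_rvZ bAB.
  - exact: (bounded_rvM bb (bounded_rv_window n rho)).
move=> /le_trans; apply.
(* Hence the constants: 16 is the window factor 4 times the shift gap 4, and 304 = 4 * 2 * 38 counts
   the heat error for both shifts. *)
rewrite [leRHS](_ : _ = 4 * (4 * rho / horizon n rho m * E b + err + err)); last first.
  by rewrite /err; field; rewrite !gt_eqF.
rewrite ler_wpM2l//; move: AB1 AB2; rewrite !ler_norml => /andP[_ ?] /andP[? _].
lra.
Qed.

(** Optional stopping: the left-hand side is E[-S_tau; tau <= n], and exit positions are at least
    -2M. The induction carries the factor 1 - P(tau > n), the probability of having exited. *)
Lemma alive_mean n : E (fun w => a n w * S n w) <= 2 * M.
Proof.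
suff H : E (fun w => a n w * S n w) <= 2 * M * (1 - p n).
  apply: le_trans H _; have := M0; have : 0 <= p n by apply: Ex_ge0 => w; exact: alive_ge0.
  nra.
elim: n => [|n ih].
  have -> : p 0 = 1.
    by rewrite -[RHS](Ex_cst P); congr Ex; apply/funext => w; rewrite alive0.
  rewrite subrr mulr0 le_eqVlt; apply/orP; left; apply/eqP.
  by rewrite -[RHS](Ex_cst P); congr Ex; apply/funext => w; rewrite walk0 mulr0.
have ban := bounded_alive n; have ban1 := bounded_alive n.+1.
have bS := bounded_walk n; have bS1 := bounded_walk n.+1.
have bk := bounded_rvB ban ban1.
have -> : E (fun w => a n.+1 w * S n.+1 w) = E (fun w => a n w * S n w)
    - E (fun w => (a n w - a n.+1 w) * S n.+1 w).
  rewrite -ExB; [|exact: bounded_rvM|exact: bounded_rvM].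
  have H := Ex_step1 (adapted_alive (leqnn n)) ban.
  have bx : bounded_rv (fun w => a n w * (u n.+1 * X n.+1 w)).
    by apply: bounded_rvM => //; apply: bounded_rvZ; exact: bX.
  rewrite -[RHS]addr0 -H -ExD//; last first.
    exact: (bounded_rvB (bounded_rvM ban bS) (bounded_rvM bk bS1)).
  by congr Ex; apply/funext => w; rewrite walkS; ring.
have : - (2 * M * E (fun w => a n w - a n.+1 w)) <=
    E (fun w => (a n w - a n.+1 w) * S n.+1 w).
  rewrite -mulNr -ExZ//; apply: le_Ex.
  - exact: bounded_rvZ.
  - exact: bounded_rvM.
  - move=> w; case: (killed_walk n w) => [->|[-> ]]; first by rewrite mulr0 mul0r.
    by rewrite ler_norml mulr1 mul1r => /andP[].
rewrite ExB//; move: ih; lra.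
Qed.

(* On survival either S_n > rho, controlled by the bounded mean of S_n, or
   |S_n| <= rho, controlled by anticoncentration after time m. *)
Lemma alive_recursion rho m n : (m <= n)%N -> 2 * M <= rho ->
  p n <= 3 * M / rho
    + p m * (16 * rho / horizon n rho m + 304 * M * (V n - V m) / rho ^+ 3).
Proof.
move=> mn Mr; have r0 : 0 < rho by have := M0; lra.
have bam := bounded_alive m; have ban := bounded_alive n.
have bI := bounded_rv_window n rho.
apply: le_trans (lerD (lexx _) (@anticoncentration (a m) rho m n mn _ _ Mr)); first last.
- by move=> w; rewrite alive_ge0 alive_le1.
- exact: adapted_alive.
(* Adding M makes the integrand nonnegative on survival, so a Markov inequality at level [rho]
   applies. Outside the window a survivor is above [rho], since S_n >= -M > -rho. *)
have h : E (fun w => a n w * S n w + M * a n w) <= 3 * M.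
  rewrite ExD; [|exact: (bounded_rvM ban (bounded_walk n))|exact: bounded_rvZ].
  rewrite ExZ//; have := alive_mean n; have : p n <= 1.
    rewrite -[leRHS](Ex_cst P); apply: le_Ex => //; first exact: bounded_rv_cst.
    exact: alive_le1.
  have := M0; nra.
have -> : 3 * M / rho = rho^-1 * (3 * M) by rewrite mulrC.
apply: le_trans (lerD (ler_wpM2l _ h) (lexx _)); last by rewrite invr_ge0 ltW.
have bs : bounded_rv (fun w => a n w * S n w + M * a n w).
  by apply: (bounded_rvD (bounded_rvM ban (bounded_walk n))); exact: bounded_rvZ.
rewrite -ExZ// -ExD; [|exact: bounded_rvZ|exact: bounded_rvM].
apply: le_Ex => //.
  by apply: bounded_rvD; [exact: bounded_rvZ|exact: bounded_rvM].
move=> w; case: (alive01 n w) => an.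
  rewrite an !mul0r mulr0 add0r mulr0 add0r mulr_ge0 ?alive_ge0//.
have am : a m w = 1.
  by apply/eqP; rewrite eq_le alive_le1/= -an alive_le.
rewrite an am !mul1r mulr1 indicE; have Sm := alive_walk an.
have [_|] := boolP (S n w \in _).
  rewrite /= lerDr mulr_ge0 ?invr_ge0 ?(ltW r0)//; lra.
rewrite notin_setE/= in_itv/= => /negP; rewrite negb_and -!ltNge => h'.
rewrite addr0 mulrC ler_pdivlMr// mul1r; case/orP: h' => ?; have := M0; lra.
Qed.

(** * Decay of the survival probability *)

Lemma alive_Ex_le1 n : p n <= 1.
Proof.
rewrite -[leRHS](Ex_cst P); apply: le_Ex; [exact: bounded_alive|exact: bounded_rv_cst|].
exact: alive_le1.
Qed.

Lemma alive_Ex_ge0 n : 0 <= p n.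
Proof. by apply: Ex_ge0 => w; exact: alive_ge0. Qed.

(** Take the last time with V_m <= V_n / 4. The next step adds at most M^2 <= V_n / 16, so V_m >= 3
    V_n / 16, more than V_n / 9; the 9 is chosen for its square root. *)
Lemma quarter_time n : 16 * M ^+ 2 <= V n ->
  exists m, [/\ (m < n)%N, V m <= V n / 4 & V n <= 9 * V m].
Proof.
move=> Vn; have M2 : 0 < M ^+ 2 by rewrite exprn_gt0.
pose Q m := (m <= n)%N && (V m <= V n / 4).
have Q0 : exists m, Q m.
  by exists 0%N; rewrite /Q walk_var0 leq0n/= divr_ge0// walk_var_ge0.
have Qn m : Q m -> (m <= n)%N by case/andP.
case: (ex_maxnP Q0 Qn) => m /andP[mn Vm] mmax.
have mn' : (m < n)%N.
  by rewrite ltn_neqAle mn andbT; apply: contraTneq Vm => ->; rewrite -ltNge; lra.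
have Vm1 : V n / 4 < V m.+1.
  rewrite ltNge; apply/negP => h.
  by have := mmax m.+1; rewrite /Q mn' h ltnn => /(_ isT).
exists m; split => //.
have sM := step_var_le m; rewrite walk_varS in Vm1; have Vm0 := walk_var_ge0 m; lra.
Qed.

Lemma quarter_horizon rho m n : (m <= n)%N -> V m <= V n / 4 ->
  Num.sqrt (V n) <= horizon n rho m.
Proof.
move=> mn Vm; rewrite horizon.unlock ler_wsqrtr//.
by have := walk_var_ge0 n; have := sqr_ge0 rho; lra.
Qed.

Local Notation K := (@survival_const R).

Lemma survival_const_ge : 2432 <= K.
Proof.
rewrite survival_const.unlock.
have : 1 <= 128 ^+ 3 :> R by apply: exprn_ege1; exact: ler1n.
move: (128 ^+ 3 : R) => q; lra.
Qed.

(** Strong induction. Small sigma is covered by p <= 1. Otherwise rho = sigma / 128 makes both terms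
    of [alive_recursion] at most 1/8, so p_n sigma <= 384 M + p_m sigma / 4, and sigma <= 3 sqrt V_m
    turns this into 384 M + (3/4) K M, at most K M because K >= 1536. *)
Lemma alive_bound n : p n * Num.sqrt (V n) <= K * M.
Proof.
have Kge := survival_const_ge.
elim/ltn_ind: n => n ih.
set sg := Num.sqrt (V n).
have sg0 : 0 <= sg by exact: sqrtr_ge0.
have p0 := alive_Ex_ge0 n; have p1 := alive_Ex_le1 n.
have [sgK|sgK] := leP sg (K * M).
  by apply: le_trans sgK; rewrite -[leRHS]mul1r ler_wpM2r.
have sgM : 2432 * M < sg by apply: le_lt_trans sgK; rewrite ler_wpM2r// ltW.
have sgp : 0 < sg by have := M0; lra.
have Vn : V n = sg ^+ 2 by rewrite sqr_sqrtr// walk_var_ge0.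
have [|m [mn Vm Vm9]] := @quarter_time n.
  by rewrite Vn; have := M0; nra.
have pm0 := alive_Ex_ge0 m.
have Mr : 2 * M <= sg / 128 by have := M0; lra.
have rec := alive_recursion (ltnW mn) Mr.
have hh := quarter_horizon (sg / 128) (ltnW mn) Vm; rewrite -/sg in hh.
have h1 : 16 * (sg / 128) / horizon n (sg / 128) m <= 1 / 8.
  rewrite ler_pdivrMr; last exact: lt_le_trans sgp hh.
  lra.
have h2 : 304 * M * (V n - V m) / (sg / 128) ^+ 3 <= 1 / 8.
  have -> : (sg / 128) ^+ 3 = sg ^+ 3 / 128 ^+ 3 by rewrite expr_div_n.
  rewrite invf_div mulrA ler_pdivrMr ?exprn_gt0//.
  apply: (@le_trans _ _ (K * M / 8 * sg ^+ 2)).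
    rewrite [leRHS](_ : _ = 304 * M * sg ^+ 2 * 128 ^+ 3); last first.
      by rewrite survival_const.unlock; move: (128 ^+ 3 : R) => q; field.
    apply: ler_wpM2r; first by apply: exprn_ge0; exact: ler0n.
    apply: ler_wpM2l; first by apply: mulr_ge0; [exact: ler0n|exact: ltW].
    rewrite Vn.
    by have := walk_var_ge0 m; lra.
  rewrite [sg ^+ 3]exprS [leRHS]mulrA; apply: ler_wpM2r; first exact: exprn_ge0.
  lra.
have h3 : 3 * M / (sg / 128) = 384 * M / sg by field; rewrite gt_eqF.
have {}rec : p n <= 384 * M / sg + p m * (1 / 4).
  apply: (le_trans rec); rewrite h3 lerD2l ler_wpM2l//.
  rewrite [leRHS](_ : _ = 1 / 8 + 1 / 8); last by field.
  exact: lerD.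
have rec2 : p n * sg <= 384 * M + p m * sg / 4.
  have -> : 384 * M + p m * sg / 4 = (384 * M / sg + p m * (1 / 4)) * sg.
    by field; rewrite gt_eqF.
  by rewrite ler_wpM2r.
have sm : sg <= 3 * Num.sqrt (V m).
  rewrite -(ger0_norm (_ : 0 <= 3))// -sqrtr_sqr -sqrtrM ?sqr_ge0// ler_wsqrtr//.
  by rewrite [3 ^+ 2](_ : _ = 9)//; ring.
have := ih m mn; have : p m * sg <= p m * (3 * Num.sqrt (V m)) by rewrite ler_wpM2l.
have := M0; nra.
Qed.

(** While V_k <= L survival is bounded by 1, afterwards by K M / sqrt L. The choice L = sigma in
    [row_estimate] makes the total O(sigma^(3/2)). *)
Lemma killed_var_sum n L : 0 < L ->
  \sum_(0 <= k < n) s k.+1 * p k <= L + M ^+ 2 + K * M / Num.sqrt L * V n.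
Proof.
move=> L0; have sL : 0 < Num.sqrt L by rewrite sqrtr_gt0.
have c0 : 0 <= K * M / Num.sqrt L.
  by have := survival_const_ge; have := M0; move=> ? ?;
    rewrite divr_ge0 ?sqrtr_ge0// mulr_ge0//; lra.
(* The minimum dominates the variance accumulated until the level L is passed, which happens with an
   excess of at most one step, hence M^2. *)
suff H : \sum_(0 <= k < n) s k.+1 * p k <=
    Num.min (V n) (L + M ^+ 2) + K * M / Num.sqrt L * V n.
  by apply: le_trans H _; rewrite lerD2r ge_min lexx orbT.
elim: n => [|n ih].
  rewrite big_geq// walk_var0 mulr0 addr0 le_min lexx/=.
  by rewrite addr_ge0 ?sqr_ge0// ltW.
rewrite big_nat_recr//= walk_varS.
have s0 := step_var_ge0 n.+1; have sM := step_var_le n.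
have p0 := alive_Ex_ge0 n; have p1 := alive_Ex_le1 n.
have [VL|VL] := leP (V n) L.
  rewrite (min_idPl _); last by lra.
  have m1 : Num.min (V n) (L + M ^+ 2) <= V n by rewrite ge_min lexx.
  have : s n.+1 * p n <= s n.+1 by rewrite ler_piMr.
  have : 0 <= K * M / Num.sqrt L * s n.+1 by rewrite mulr_ge0.
  by move: ih m1; rewrite mulrDr; lra.
have m1 : Num.min (V n) (L + M ^+ 2) <= Num.min (V n + s n.+1) (L + M ^+ 2).
  by rewrite le_min !ge_min lexx orbT lerDl s0.
have pK : p n <= K * M / Num.sqrt L.
  rewrite ler_pdivlMr//; apply: le_trans (alive_bound n).
  by rewrite ler_wpM2l// ler_wsqrtr// ltW.
have : s n.+1 * p n <= s n.+1 * (K * M / Num.sqrt L) by rewrite ler_wpM2l.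
by move: ih m1; rewrite mulrDr; lra.
Qed.

(** * Comparison of survival with the exit position *)

Lemma pi_half_le1 : Num.sqrt pi / 2 <= 1 :> R.
Proof.
rewrite ler_pdivrMr// mul1r -[leRHS](ger0_norm (_ : 0 <= 2))// -sqrtr_sqr.
by rewrite ler_wsqrtr//; have /andP[_] := @pihalf_02 R; lra.
Qed.

Lemma alive_window n rho : 4 * M <= Num.sqrt (V n) -> 2 * M <= rho ->
  E (fun w => a n w * \1_`[- rho, rho] (S n w)) * Num.sqrt (V n) <=
  3 * (K * M) * (16 * rho / Num.sqrt (V n) + 304 * M * V n / rho ^+ 3).
Proof.
set sg := Num.sqrt (V n) => sgM Mr.
have r0 : 0 < rho by have := M0; lra.
have sg0 : 0 < sg by have := M0; lra.
have Vn : V n = sg ^+ 2 by rewrite sqr_sqrtr// walk_var_ge0.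
have [|m [mn Vm Vm9]] := @quarter_time n.
  by rewrite Vn; have := M0; nra.
have hh := quarter_horizon rho (ltnW mn) Vm; rewrite -/sg in hh.
have bI := bounded_rv_window n rho.
have am01 w : 0 <= a m w <= 1 by rewrite alive_ge0 alive_le1.
have H := anticoncentration (ltnW mn) (adapted_alive (leqnn m)) am01 Mr.
have H1 : E (fun w => a n w * \1_`[- rho, rho] (S n w)) <=
    p m * (16 * rho / sg + 304 * M * V n / rho ^+ 3).
  apply: (@le_trans _ _ (E (fun w => a m w * \1_`[- rho, rho] (S n w)))).
    apply: le_Ex; [exact: (bounded_rvM (bounded_alive n) bI)|
                   exact: (bounded_rvM (bounded_alive m) bI)|].
    by move=> w; rewrite ler_wpM2r ?alive_le ?(ltnW mn).
  apply: (le_trans H); rewrite ler_wpM2l ?alive_Ex_ge0//; apply: lerD.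
    rewrite ler_wpM2l ?mulr_ge0 ?(ltW r0)// lef_pV2 ?posrE//.
    exact: lt_le_trans sg0 hh.
  apply: ler_wpM2r; first by rewrite invr_ge0; apply: exprn_ge0; exact: ltW.
  apply: ler_wpM2l; first by apply: mulr_ge0; [exact: ler0n|exact: ltW].
  by have := walk_var_ge0 m; lra.
have sm : sg <= 3 * Num.sqrt (V m).
  rewrite -(ger0_norm (_ : 0 <= 3))// -sqrtr_sqr -sqrtrM ?sqr_ge0// ler_wsqrtr//.
  by rewrite [3 ^+ 2](_ : _ = 9)//; ring.
have Q0 : 0 <= 16 * rho / sg + 304 * M * V n / rho ^+ 3.
  apply: addr_ge0.
    apply: divr_ge0; last exact: ltW.
    by apply: mulr_ge0; [exact: ler0n|exact: ltW].
  apply: divr_ge0; last by apply: exprn_ge0; exact: ltW.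
  apply: mulr_ge0; last exact: walk_var_ge0.
  by apply: mulr_ge0; [exact: ler0n|exact: ltW].
have pm : p m * sg <= 3 * (K * M).
  have := alive_bound m; have : p m * sg <= p m * (3 * Num.sqrt (V m)).
    by rewrite ler_wpM2l// alive_Ex_ge0.
  lra.
apply: le_trans (ler_wpM2r (ltW sg0) H1) _.
by rewrite mulrAC ler_wpM2r.
Qed.

(** This is E[-erf0 (S_tau / horizon_tau); tau <= n], summed over the possible exit times. *)
Definition overshoot (n : nat) (rho : R) : R :=
  - \sum_(0 <= k < n) E (fun w => (a k w - a k.+1 w) *
        erf0 (S k.+1 w / horizon n rho k.+1)).

(** The three summands are: the heat error, with [killed_var_sum] at L = sigma; survivors above l
    rho, where [erf0] has nearly reached its limit; and survivors in the window of half-width l rho,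
    where the limit exceeds [erf0] by at most 2. *)
Lemma row_estimate n (del l : R) :
  let sg := Num.sqrt (V n) in
  0 < del -> 1 <= l -> 4 * M <= sg -> 2 * M <= del * sg ->
  `|sg * p n * (Num.sqrt pi / 2) - sg * overshoot n (del * sg)| <=
  38 * M / del ^+ 3 * (sg^-1 + M ^+ 2 / sg ^+ 2 + K * M / Num.sqrt sg)
  + K * M * (Num.sqrt pi / 2 - erf0 l)
  + 6 * (K * M) * (16 * (l * del) + 304 * M / (l * del) ^+ 3 / sg).
Proof.
move=> sg del0 l1 sgM Mr.
set rho := del * sg in Mr *.
have sg0 : 0 < sg by have := M0; lra.
have r0 : 0 < rho by rewrite mulr_gt0.
have l0 : 0 < l by lra.
have Vn : V n = sg ^+ 2 by rewrite sqr_sqrtr// walk_var_ge0.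
have Mlr : 2 * M <= l * rho by apply: le_trans Mr _; rewrite ler_peMl// ltW.
pose W w := a n w * erf0 (S n w / rho).
have ban := bounded_alive n.
have bW : bounded_rv W.
  apply: (bounded_rvM ban); apply: bounded_rv_erf0.
  by apply: (bounded_rvM (bounded_walk n)); exact: bounded_rv_cst.
pose c := Num.sqrt pi / 2 : R.
have bc : bounded_rv (fun w => c * a n w) by exact: bounded_rvZ.
have T1 := alive_telescope n Mr.
have -> : sg * p n * c - sg * overshoot n rho =
    sg * (E W + \sum_(0 <= k < n) E (fun w => (a k w - a k.+1 w) *
        erf0 (S k.+1 w / horizon n rho k.+1))) + sg * (c * p n - E W).
  by rewrite /overshoot; ring.
apply: le_trans (ler_normD _ _) _; rewrite -addrA; apply: lerD.
  rewrite normrM (gtr0_norm sg0); apply: le_trans (ler_wpM2l (ltW sg0) T1) _.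
  apply: le_trans (ler_wpM2l (ltW sg0) (ler_wpM2l _ (killed_var_sum n sg0))) _.
    apply: divr_ge0; last by apply: exprn_ge0; exact: ltW.
    by apply: mulr_ge0; [exact: ler0n|exact: ltW].
  rewrite Vn /rho le_eqVlt; apply/orP; left; apply/eqP; field.
  by rewrite !gt_eqF// sqrtr_gt0.
have D0 : 0 <= c * p n - E W.
  rewrite -ExZ// -ExB//; apply: Ex_ge0 => w.
  by rewrite /W mulrC -mulrBr mulr_ge0 ?alive_ge0// subr_ge0 erf0_le.
rewrite ger0_norm ?mulr_ge0 ?(ltW sg0)//.
pose I w : R := \1_`[- (l * rho), (l * rho)] (S n w).
have bI : bounded_rv I := bounded_rv_window n (l * rho).
have c1 : c <= 1 := pi_half_le1.
have D1 : c * p n - E W <= (c - erf0 l) * p n + 2 * E (fun w => a n w * I w).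
  have b1 : bounded_rv (fun w => (c - erf0 l) * a n w) by exact: bounded_rvZ.
  have b2 : bounded_rv (fun w => a n w * I w) by exact: bounded_rvM.
  have b3 : bounded_rv (fun w => 2 * (a n w * I w)) by exact: bounded_rvZ.
  rewrite -ExZ// -ExB// -ExZ// -[2 * _]ExZ// -ExD//; apply: le_Ex.
  - exact: (bounded_rvB bc bW).
  - exact: (bounded_rvD b1 b3).
  move=> w; rewrite /W; case: (alive01 n w) => an.
    by rewrite an !mulr0 !mul0r subrr mulr0 addr0.
  rewrite an !mulr1 !mul1r /I indicE; have Sm := alive_walk an.
  have el : erf0 l <= 1 := le_trans (erf0_le l) c1.
  have [_|] := boolP (S n w \in _).
    have : - 1 <= erf0 (S n w / rho).
      have : erf0 (-1) <= erf0 (S n w / rho).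
        by apply: erf0_homo; rewrite ler_pdivlMr//; have := M0; lra.
      have := erf0_lipschitz 0 (-1 : R); rewrite erf00 !subr0 normrN1 ler_norml.
      by move=> /andP[? _] ?; lra.
    rewrite /= mulr1; lra.
  rewrite notin_setE/= in_itv/= => /negP; rewrite negb_and -!ltNge => h'.
  rewrite mulr0 addr0 lerD2l lerN2; apply: erf0_homo; rewrite ler_pdivlMr//.
  case/orP: h' => ?; have := M0; lra.
apply: le_trans (ler_wpM2l (ltW sg0) D1) _.
rewrite mulrDr; apply: lerD.
  rewrite mulrCA [leRHS]mulrC ler_wpM2l ?subr_ge0 ?erf0_le// mulrC.
  exact: alive_bound.
have AW := @alive_window n (l * rho) sgM Mlr.
rewrite -/sg in AW.
have -> : sg * (2 * E (fun w => a n w * I w)) = 2 * (E (fun w => a n w * I w) * sg) by ring.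
apply: le_trans (ler_wpM2l _ AW) _ => //.
rewrite Vn /rho le_eqVlt; apply/orP; left; apply/eqP; field.
by rewrite !gt_eqF.
Qed.

End row.
(** * First passage times *)

Section passage.
Variables (R : realType) (s b : nat -> R).

Lemma passage_afterP n :
  reflect (forall j, (1 <= j <= n)%N -> b j < s j)
    (passage_after (first_passage s b) n).
Proof.
rewrite /first_passage; case: pselect => [h|h]; last first.
  apply: (iffP idP) => // _ j /andP[j1 _]; rewrite ltNge; apply/negP => sj.
  by apply: h; exists j; rewrite j1.
case: ex_minnP => k /andP[k1 sk] kmin; apply: (iffP idP) => /= [nk j /andP[j1 jn]|H].
  rewrite ltNge; apply/negP => sj.
  by have := kmin j; rewrite j1 sj leqNgt (leq_ltn_trans jn nk) => /(_ isT).
by rewrite ltnNge; apply/negP => kn; have := H k; rewrite k1 kn ltNge sk => /(_ isT).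
Qed.

Lemma first_passage_some K : first_passage s b = Some K ->
  [/\ (0 < K)%N, s K <= b K & forall j, (1 <= j < K)%N -> b j < s j].
Proof.
rewrite /first_passage; case: pselect => // h.
case: ex_minnP => k /andP[k1 sk] kmin [<-]; split => // j /andP[j1 jk].
rewrite ltNge; apply/negP => sj.
by have := kmin j; rewrite j1 sj leqNgt jk => /(_ isT).
Qed.

End passage.

Section alive_passage.
Context d (T : measurableType d) (R : realType).
Variables (X : nat -> T -> R) (u G : nat -> R).
Local Notation S := (walk X u).
Local Notation a := (alive X u G).

Lemma aliveP k w : a k w = 1 <-> forall j, (1 <= j <= k)%N -> G j < S j w.
Proof.
elim: k => [|k [ih1 ih2]]; first by rewrite alive0; split => // _ [].
rewrite aliveS indic_gt; split.
  case: (alive01 X u G k w) => ak; rewrite ak ?mul0r ?mul1r.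
    by move=> /esym/eqP; rewrite oner_eq0.
  case: ltP => // h; last by move=> /esym/eqP; rewrite oner_eq0.
  move=> _ j /andP[j1]; rewrite leq_eqVlt => /predU1P[-> //|jk].
  by apply: ih1 ak _ _; rewrite j1.
move=> H; rewrite ih2; last first.
  by move=> j /andP[j1 jk]; apply: H; rewrite j1 leqW.
by rewrite H ?mulr1// leqnn.
Qed.

Lemma alive_dead k w j : (1 <= j <= k)%N -> S j w <= G j -> a k w = 0.
Proof.
move=> jk Sj; case: (alive01 X u G k w) => // /aliveP /(_ j jk).
by rewrite ltNge Sj.
Qed.

(** The weights are nonnegative and telescope to at most 1. *)
Lemma killed_sum_bound (F : nat -> R) (C : R) n w : 0 <= C ->
  (forall k, (k < n)%N -> a k w - a k.+1 w != 0 -> `|F k| <= C) ->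
  `|\sum_(0 <= k < n) (a k w - a k.+1 w) * F k| <= C.
Proof.
move=> C0 FC; apply: le_trans (ler_norm_sum _ _ _) _.
apply: (@le_trans _ _ (\sum_(0 <= k < n) C * (a k w - a k.+1 w))).
  apply: ler_sum_nat => k /andP[_ kn].
  have k0 : 0 <= a k w - a k.+1 w by rewrite subr_ge0 aliveS_le.
  rewrite normrM (ger0_norm k0).
  have [->|nz] := eqVneq (a k w - a k.+1 w) 0; first by rewrite mul0r mulr0.
  by rewrite mulrC ler_wpM2r// FC.
rewrite -mulr_sumr.
have -> : \sum_(0 <= k < n) (a k w - a k.+1 w) = a 0 w - a n w.
  elim: n {FC} => [|n ih]; first by rewrite big_geq// subrr.
  by rewrite big_nat_recr//= ih addrA subrK.
by rewrite alive0 ler_piMr// gerBl alive_ge0.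
Qed.

Lemma killed_sum_at (F : nat -> R) K n w : (K < n)%N ->
  (forall j, (1 <= j <= K)%N -> G j < S j w) -> S K.+1 w <= G K.+1 ->
  \sum_(0 <= k < n) (a k w - a k.+1 w) * F k = F K.
Proof.
move=> Kn H1 H2.
have a1 k : (k <= K)%N -> a k w = 1.
  by move=> kK; apply/aliveP => j /andP[j1 jk]; apply: H1; rewrite j1 (leq_trans jk).
have a0 k : (K < k)%N -> a k w = 0.
  by move=> kK; apply: (@alive_dead k w K.+1) => //.
rewrite big_mkord (bigD1 (Ordinal Kn))//= a1// a0// subr0 mul1r big1 ?addr0//.
move=> i; rewrite -val_eqE/= => iK.
have [ik|ik] := ltnP i K; first by rewrite (a1 _ (ltnW ik)) (a1 _ ik) subrr mul0r.
have Ki : (K < i)%N by rewrite ltn_neqAle ik eq_sym iK.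
by rewrite (a0 _ Ki) (a0 _ (leqW Ki)) subrr mul0r.
Qed.

Lemma killed_sum_alive (F : nat -> R) n w :
  (forall j, (1 <= j <= n)%N -> G j < S j w) ->
  \sum_(0 <= k < n) (a k w - a k.+1 w) * F k = 0.
Proof.
move=> H; rewrite big_nat big1// => k /andP[_ kn].
have a1 i : (i <= n)%N -> a i w = 1.
  by move=> iK; apply/aliveP => j /andP[j1 jk]; apply: H; rewrite j1 (leq_trans jk).
by rewrite (a1 _ (ltnW kn)) (a1 _ kn) subrr mul0r.
Qed.

End alive_passage.

Definition minus_stopped (T : Type) (R : realType) (X : nat -> T -> R)
  (u g : nat -> R) (w : T) : R :=
  - stopped (fun k => walk X u k w) (first_passage (fun k => walk X u k w) g).

(** * Measurability of the stopped walk and of survival *)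

Section measurability.
Context d (T : measurableType d) (R : realType).
Variables (X : nat -> T -> R) (u g : nat -> R).
Hypothesis mX : forall i, measurable_fun setT (X i).

Lemma measurable_walk k : measurable_fun setT (walk X u k).
Proof. exact: (adapted_measurable mX (@adapted_walk _ T R X u k k (leqnn k))). Qed.

(** A pointwise limit of finite sums over the exit time, eventually constant at each point; where no
    exit occurs the sums vanish, in accordance with the default value 0 of [stopped]. *)
Lemma measurable_minus_stopped : measurable_fun setT (minus_stopped X u g).
Proof.
pose y N w := - \sum_(0 <= k < N) (alive X u g k w - alive X u g k.+1 w) * walk X u k.+1 w.
apply: (@measurable_fun_cvg _ _ _ setT y).
  move=> N; apply: measurableT_comp => //; apply: measurable_sum => k.
  have ba i := (bounded_alive mX u g i).1.
  by apply: measurable_funM; [exact: measurable_funB|exact: measurable_walk].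
move=> w _; apply: cvg_near_cst.
rewrite /minus_stopped /y; case E1 : first_passage => [K|].
  have [K0 SK SJ] := first_passage_some E1.
  case: K K0 SK SJ {E1} => // K _ SK SJ.
  near=> N; congr (- _); rewrite (@killed_sum_at _ _ _ _ _ _ _ K)//.
  by near: N; exact: nbhs_infty_gt.
near=> N; congr (- _); rewrite killed_sum_alive//= => j jN.
move: E1; rewrite /first_passage; case: pselect => // h _.
by rewrite ltNge; apply/negP => sj; apply: h; exists j; rewrite sj; case/andP: jN => ->.
Unshelve. all: end_near. Qed.

Lemma measurable_survival n :
  measurable [set w | passage_after (first_passage (fun k => walk X u k w) g) n].
Proof.
rewrite (_ : [set _ | _] = alive X u g n @^-1` [set 1]).
  rewrite -[X in measurable X]setTI.
  exact: (bounded_alive mX u g n).1 measurableT _ (measurable_set1 1).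
apply/seteqP; split => w /=; first by move=> /passage_afterP h; exact/aliveP.
by move/aliveP => h; exact/passage_afterP.
Qed.

End measurability.

(** * Almost sure absence of contact with the boundary *)

Section no_contact.
Context d (T : measurableType d) (R : realType) (P : probability T R).
Variable X : nat -> T -> R.
Hypothesis mX : forall i, measurable_fun setT (X i).
Hypothesis indepX : independent_seq P X.
Hypothesis noatom : forall i x, (1 <= i)%N -> P [set w | X i w = x] = 0%E.

(* Condition on the past of the last step with a nonzero weight. *)
Lemma walk_noatom (u : nat -> R) (c : R) k :
  (exists2 j, (1 <= j <= k)%N & u j != 0) -> P [set w | walk X u k w = c] = 0%E.
Proof.
elim: k => [|k ih]; first by case=> [[]].
case: (eqVneq (u k.+1) 0) => [u0|u1 _].
  move=> [j /andP[j1]]; rewrite leq_eqVlt => /predU1P[->|jk] uj.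
    by rewrite u0 eqxx in uj.
  rewrite -ih; last by exists j => //; rewrite j1.
  by congr (P _); apply/funext => w /=; rewrite walkS u0 mul0r addr0.
rewrite -[RHS](@indep_noatom _ _ _ P X mX indepX k (walk X u k) (u k.+1) c)//.
- by congr (P _); apply/funext => w /=; rewrite walkS.
- exact: adapted_walk.
- by move=> x; exact: noatom.
Qed.

(** If some weight up to k is nonzero, S_k has no atom. Otherwise the walk vanishes identically up
    to k, and touching the boundary there for the first time is exactly [degenerate_contact]. *)
Lemma no_contact_ae (u g : nat -> R) : ~ degenerate_contact u g ->
  {ae P, forall w k, (0 < k)%N -> (forall j, (1 <= j < k)%N -> g j < walk X u j w) ->
     walk X u k w != g k}.
Proof.
move=> nd; apply: ae_foralln => k.
have [k0|k0] := posnP k; first by apply: aeW => w; rewrite k0.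
have [h|h] := pselect (exists2 j, (1 <= j <= k)%N & u j != 0).
  exists [set w | walk X u k w = g k]; split.
  - rewrite -[X in measurable X]setTI.
    have mS := adapted_measurable mX (@adapted_walk _ T R X u k k (leqnn k)).
    by have := mS measurableT _ (measurable_set1 (g k)).
  - exact: walk_noatom.
  - move=> w /= nw; apply: contrapT => /eqP h'; apply: nw => _ _; exact: h'.
have u0 j : (1 <= j <= k)%N -> u j = 0.
  by move=> jk; apply/eqP; apply: contrapT => /negP uj; apply: h; exists j.
have S0 j w : (j <= k)%N -> walk X u j w = 0.
  move=> jk; rewrite walk.unlock big_nat big1// => i /andP[i1 ij].
  by rewrite u0 ?mul0r// i1 (leq_trans _ jk).
apply: aeW => w _ H; apply/eqP => Sk; apply: nd; exists k; split => //.
- by move=> j /andP[j1 jk]; rewrite -(S0 j w (ltnW jk)) H// j1.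
- by rewrite -Sk S0.
Qed.

End no_contact.
(** * The limit along the rows *)

(* Only the entries 1 <= k <= n of a row satisfy the uniform bound. *)
Definition cut (R : realType) (c : nat -> nat -> R) (n k : nat) : R :=
  if (1 <= k <= n)%N then c k n else 0.

Lemma near_forall_le (K : nat) (Q : nat -> nat -> Prop) :
  (forall j, (j <= K)%N -> \forall n \near \oo, Q j n) ->
  \forall n \near \oo, forall j, (j <= K)%N -> Q j n.
Proof.
elim: K => [|K ih] H.
  by near=> n => j; rewrite leqn0 => /eqP ->; near: n; exact: H.
near=> n => j; rewrite leq_eqVlt => /predU1P[->|]; first by near: n; exact: H.
move: j; near: n; apply: ih => j jK; exact/H/leqW.
Unshelve. all: end_near. Qed.

Section scaled_erf.
Variable R : realType.

(** Linearisation at 0: by [erf0_sub_id], replacing erf0 (x/h) by x/h costs at most 2 (s x / h)^2 /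
    s, which tends to 0. *)
Lemma cvg_scaled_erf0 (x_ h_ s_ : nat -> R) (x c : R) :
  x_ n @[n --> \oo] --> x -> s_ n @[n --> \oo] --> +oo ->
  s_ n / h_ n @[n --> \oo] --> c ->
  s_ n * erf0 (x_ n / h_ n) @[n --> \oo] --> c * x.
Proof.
move=> xx soo shc.
rewrite -[c * x]addr0.
have -> : (fun n => s_ n * erf0 (x_ n / h_ n)) = (fun n => (s_ n / h_ n) * x_ n
    + s_ n * (erf0 (x_ n / h_ n) - x_ n / h_ n)).
  by apply/funext => n; ring.
apply: cvgD; first exact: cvgM.
have sV : (s_ n)^-1 @[n --> \oo] --> (0 : R).
  by apply/gtr0_cvgV0 => //; exact: cvgry_gt.
have z0 : 2 * (s_ n / h_ n * x_ n * (s_ n / h_ n * x_ n)) * (s_ n)^-1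
    @[n --> \oo] --> 2 * (c * x * (c * x)) * 0.
  have cx : s_ n / h_ n * x_ n @[n --> \oo] --> c * x by exact: cvgM.
  apply: cvgM sV; apply: cvgM; [exact: cvg_cst|exact: cvgM].
rewrite mulr0 in z0.
apply/norm_cvg0P; apply: (@squeeze_cvgr _ _ _ _ (fun=> 0) _ _ _ _ _ z0).
- near=> n; rewrite normr_ge0/=.
  have s0 : 0 < s_ n by near: n; exact: cvgry_gt.
  rewrite normrM (gtr0_norm s0).
  apply: le_trans (ler_wpM2l (ltW s0) (erf0_sub_id _)) _.
  rewrite real_normK ?num_real// le_eqVlt; apply/orP; left; apply/eqP.
  have -> : s_ n / h_ n * x_ n = s_ n * (x_ n / h_ n) by ring.
  by move: (x_ n / h_ n) => z; field; rewrite gt_eqF.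
- exact: cvg_cst.
Unshelve. all: end_near. Qed.

End scaled_erf.

(** * The limit for pointwise bounded variables *)

Section bounded_case.
Context d (T : measurableType d) (R : realType) (P : probability T R).
Variable X : nat -> T -> R.
Hypothesis mX : forall i, measurable_fun setT (X i).
Hypothesis indepX : independent_seq P X.
Hypothesis noatom : forall i x, (1 <= i)%N -> P [set w | X i w = x] = 0%E.
Hypothesis X0 : forall i, (1 <= i)%N -> Ex P (X i) = 0.
Variables (Mb : nat -> R) (u G : nat -> nat -> R) (ul gl : nat -> R) (M : R).
Hypothesis XM : forall i w, (1 <= i)%N -> `|X i w| <= Mb i.
Hypothesis M0 : 0 < M.
Hypothesis uGM : forall k n, (1 <= k <= n)%N -> `|u k n| * Mb k + `|G k n| <= M.
Hypothesis var_infty : walk_var P X (cut u n) n @[n --> \oo] --> +oo.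
Hypothesis u_cvg : forall k, (1 <= k)%N -> u k n @[n --> \oo] --> ul k.
Hypothesis G_cvg : forall k, (1 <= k)%N -> G k n @[n --> \oo] --> gl k.
Hypothesis no_contact : ~ degenerate_contact ul gl.

Local Notation E := (Ex P).
Local Notation tau w := (first_passage (fun k => walk X ul k w) gl).
Hypothesis tau_finite : {ae P, forall w, tau w <> None}.

Let U n := cut u n.
Let H n := cut G n.
Let S n := walk X (U n).
Let a n := alive X (U n) (H n).
Let V n := walk_var P X (U n) n.
Let sg n : R := Num.sqrt (V n).

Let bX i : (1 <= i)%N -> bounded_rv (X i).
Proof. by move=> i1; split => //; exists (Mb i) => w; exact: XM. Qed.

Let uXGM k n w : (1 <= k <= n)%N -> `|u k n * X k w| + `|G k n| <= M.
Proof.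
move=> kn; apply: le_trans (uGM kn); rewrite lerD2r normrM ler_wpM2l// XM//.
by case/andP: kn.
Qed.

Let UM n i w : (1 <= i)%N -> `|U n i * X i w| <= M.
Proof.
move=> i1; rewrite /U /cut; case: ifP => [h|_].
  by apply: le_trans (uXGM w h); rewrite lerDl.
by rewrite mul0r normr0 ltW.
Qed.

Let HM n i : (1 <= i)%N -> `|H n i| <= M.
Proof.
move=> i1; rewrite /H /cut; case: ifP => [h|_].
  apply: le_trans (uGM h); rewrite lerDr mulr_ge0//.
  (* Nonnegativity of [Mb i] is read off at an arbitrary sample point. *)
  exact: le_trans (normr_ge0 _) (XM (point : T) i1).
by rewrite normr0 ltW.
Qed.

Let U_cvg k : (1 <= k)%N -> U n k @[n --> \oo] --> ul k.
Proof.
move=> k1; apply: cvg_trans (u_cvg k1); apply: near_eq_cvg.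
by near=> n; rewrite /U /cut k1 ifT//; near: n; exact: nbhs_infty_ge.
Unshelve. all: end_near. Qed.

Let H_cvg k : (1 <= k)%N -> H n k @[n --> \oo] --> gl k.
Proof.
move=> k1; apply: cvg_trans (G_cvg k1); apply: near_eq_cvg.
by near=> n; rewrite /H /cut k1 ifT//; near: n; exact: nbhs_infty_ge.
Unshelve. all: end_near. Qed.

Let ulM i w : (1 <= i)%N -> `|ul i * X i w| <= M.
Proof.
move=> i1; apply: (@cvgr_to_le nat \oo _ _ (fun n => `|U n i * X i w|)).
  by apply: cvg_norm; apply: cvgM; [exact: U_cvg|exact: cvg_cst].
by near=> n; exact: UM.
Unshelve. all: end_near. Qed.

Let glM i : (1 <= i)%N -> `|gl i| <= M.
Proof.
move=> i1; apply: (@cvgr_to_le nat \oo _ _ (fun n => `|H n i|)).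
  by apply: cvg_norm; exact: H_cvg.
by near=> n; exact: HM.
Unshelve. all: end_near. Qed.

Let S_cvg k w : S n k w @[n --> \oo] --> walk X ul k w.
Proof.
elim: k => [|k ih].
  by rewrite walk0; apply: cvg_near_cst; near=> n; rewrite /S walk0.
rewrite walkS; under eq_fun do rewrite /S walkS.
apply: cvgD; first exact: ih.
by apply: cvgM; [exact: U_cvg|exact: cvg_cst].
Unshelve. all: end_near. Qed.

Local Notation Y := (minus_stopped X ul gl).

(** The limiting weights and boundary inherit the bound M, so the one-step argument of [killed_walk]
    applies to the limiting walk as well. *)
Let bounded_Y : bounded_rv Y.
Proof.
split; last first.
  exists (2 * M) => w; rewrite /minus_stopped normrN; case E1 : (tau w) => [K|/=]; last first.
    by rewrite normr0 mulr_ge0// ltW.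
  have [K0 SK SJ] := first_passage_some E1.
  case: K K0 SK SJ {E1} => // K _ SK SJ.
  have a1 : alive X ul gl K w = 1 by apply/aliveP.
  have a0 : alive X ul gl K.+1 w = 0 by apply: (@alive_dead _ _ _ _ _ _ _ _ K.+1) => /=.
  have [] := killed_walk M0 ulM glM K w; rewrite a1 a0 subr0.
    by move/eqP; rewrite oner_eq0.
  by case.
exact: measurable_minus_stopped.
Qed.

Let sg_infty : sg n @[n --> \oo] --> +oo.
Proof.
apply/cvgryPge => A; near=> n.
have [A0|A0] := leP A 0; first exact: le_trans A0 (sqrtr_ge0 _).
rewrite -(gtr0_norm A0) -sqrtr_sqr ler_wsqrtr//; near: n.
by move/cvgryPge : var_infty; exact.
Unshelve. all: end_near. Qed.

Let h n del k := horizon P X (U n) n (del * sg n) k.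

(** The integrand of [sg n * overshoot], kept as a random variable so that dominated convergence can
    be applied. *)
Let fn (del : R) n w := - \sum_(0 <= k < n) (a n k w - a n k.+1 w) *
  (sg n * erf0 (S n k.+1 w / h n del k.+1)).

Let bounded_term n k c r : bounded_rv (fun w => (a n k w - a n k.+1 w) *
  (c * erf0 (S n k.+1 w / r))).
Proof.
have ba i := bounded_alive mX (U n) (H n) i.
have bS : bounded_rv (S n k.+1) := bounded_walk bX (U n) k.+1.
apply: (bounded_rvM (bounded_rvB (ba k) (ba k.+1))); apply: bounded_rvZ.
by apply: bounded_rv_erf0; apply: (bounded_rvM bS); exact: bounded_rv_cst.
Qed.

Let bounded_fn del n : bounded_rv (fn del n).
Proof.
by apply: bounded_rvN; apply: bounded_rv_sum => k; exact: bounded_term.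
Qed.

Let overshootE del n : sg n * overshoot P X (U n) (H n) n (del * sg n) = E (fn del n).
Proof.
rewrite /overshoot /fn mulrN mulr_sumr.
transitivity (- E (fun w => \sum_(0 <= k < n) (a n k w - a n k.+1 w) *
  (sg n * erf0 (S n k.+1 w / h n del k.+1)))).
  congr (- _); rewrite Ex_sum//; apply: eq_bigr => k _.
  rewrite -ExZ; first by congr Ex; apply/funext => w; rewrite mulrCA.
  have := bounded_term n k 1 (h n del k.+1).
  by under eq_fun do rewrite mul1r.
rewrite -mulN1r -ExZ; last by apply: bounded_rv_sum => k; exact: bounded_term.
by congr Ex; apply/funext => w; rewrite mulN1r.
Qed.

(** The scale cancels: [erf0] is 1-Lipschitz, exit positions are at most 2M in modulus, and the
    horizon is at least [del * sg n]. If [sg n] is 0 that lower bound is void, but the prefactor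
    vanishes. *)
Let fn_bound del n w : 0 < del -> `|fn del n w| <= 2 * M / del.
Proof.
move=> del0; have C0 : 0 <= 2 * M / del by rewrite divr_ge0 ?mulr_ge0 ?(ltW M0) ?(ltW del0).
rewrite normrN; apply: killed_sum_bound => // k kn nz.
have [Z|[_ Sk]] := killed_walk M0 (UM n) (HM n) k w.
  by rewrite Z eqxx in nz.
have [sg0|sg0] := eqVneq (sg n) 0; first by rewrite sg0 mul0r normr0.
have sgp : 0 < sg n by rewrite lt_def sg0 sqrtr_ge0.
have r0 : 0 < del * sg n by rewrite mulr_gt0.
have hr : del * sg n <= h n del k.+1 by apply: horizon_ge => //; exact: ltW.
have hp : 0 < h n del k.+1 by exact: lt_le_trans hr.
rewrite normrM (gtr0_norm sgp).
have := erf0_lipschitz 0 (S n k.+1 w / h n del k.+1); rewrite erf00 !subr0 => he.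
apply: le_trans (ler_wpM2l (ltW sgp) he) _.
rewrite normrM normfV (gtr0_norm hp) mulrA ler_pdivrMr//.
apply: (@le_trans _ _ (2 * M / del * (del * sg n))); last by rewrite ler_wpM2l.
rewrite [leRHS](_ : _ = sg n * (2 * M)); last by field; rewrite gt_eqF.
by rewrite ler_wpM2l// ltW.
Qed.

(** For fixed k the first k steps carry variance at most k M^2, negligible against V_n. *)
Let horizon_cvg del k : 0 < del ->
  sg n / h n del k @[n --> \oo] --> (Num.sqrt (2 + del ^+ 2))^-1.
Proof.
move=> del0.
have VV : walk_var P X (U n) k / V n @[n --> \oo] --> (0 : R).
  have Vk n : walk_var P X (U n) k <= k%:R * M ^+ 2.
    elim: k => [|k ih]; first by rewrite walk_var0 mul0r.
    rewrite walk_varS -natr1 mulrDl mul1r lerD//.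
    exact: (step_var_le P bX M0 (UM n) k).
  have Vi : k%:R * M ^+ 2 * (V n)^-1 @[n --> \oo] --> (0 : R).
    rewrite -[0](mulr0 (k%:R * M ^+ 2)); apply: cvgM; first exact: cvg_cst.
    by apply/gtr0_cvgV0 => //; exact: cvgry_gt.
  apply: (@squeeze_cvgr _ _ _ _ (fun=> 0) _ _ _ _ _ Vi); last exact: cvg_cst.
  near=> n; have V0 : 0 <= V n := walk_var_ge0 _ _ _ _.
  by rewrite divr_ge0 ?walk_var_ge0//= ler_wpM2r// invr_ge0.
have L : 0 < Num.sqrt (2 + del ^+ 2) by rewrite sqrtr_gt0; have := sqr_ge0 del; lra.
have : Num.sqrt (2 * (1 - walk_var P X (U n) k / V n) + del ^+ 2) @[n --> \oo] -->
    Num.sqrt (2 * (1 - 0) + del ^+ 2).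
  apply: continuous_cvg; first exact: sqrt_continuous.
  apply: cvgD; last exact: cvg_cst.
  by apply: cvgM; [exact: cvg_cst|apply: cvgB => //; exact: cvg_cst].
rewrite subr0 mulr1 => /(cvgV _) => /(_ (lt0r_neq0 L)).
apply: cvg_trans; apply: near_eq_cvg; near=> n.
have V0 : 0 < V n by near: n; exact: cvgry_gt.
have sg0 : 0 < sg n by rewrite sqrtr_gt0.
have kn : (k <= n)%N by near: n; exact: nbhs_infty_ge.
have Vn : V n = sg n ^+ 2 by rewrite sqr_sqrtr// ltW.
rewrite /h horizon.unlock -/(V n).
have -> : 2 * (V n - walk_var P X (U n) k) + (del * sg n) ^+ 2 =
    V n * (2 * (1 - walk_var P X (U n) k / V n) + del ^+ 2).
  by rewrite exprMn -Vn; field; rewrite gt_eqF.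
rewrite (sqrtrM _ (ltW V0)) -/(sg n) invfM mulrA divff ?mul1r//.
by rewrite gt_eqF.
Unshelve. all: end_near. Qed.

(** Almost surely tau = K + 1 is finite and, without contact, the limiting walk is strictly above
    the boundary before that time and strictly below it then. These finitely many strict
    inequalities persist in row n for large n, so the row exits at the same time and its sum reduces
    to one term. *)
Let fn_cvg del : 0 < del -> {ae P, forall w,
  fn del n w @[n --> \oo] --> (Num.sqrt (2 + del ^+ 2))^-1 * Y w}.
Proof.
move=> del0.
have nc := no_contact_ae mX indepX noatom no_contact.
apply: filterS2 nc tau_finite => w nw tw.
rewrite /minus_stopped; case E1 : (tau w) tw => [K|//] _ /=.
have [K0 SK SJ] := first_passage_some E1.
case: K K0 SK SJ {E1} => // K _ SK SJ.
have {}SK : walk X ul K.+1 w < gl K.+1 by rewrite lt_neqAle SK nw.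
rewrite mulrN.
have F : - (sg n * erf0 (S n K.+1 w / h n del K.+1)) @[n --> \oo] -->
    - ((Num.sqrt (2 + del ^+ 2))^-1 * walk X ul K.+1 w).
  apply: cvgN; apply: cvg_scaled_erf0; [exact: S_cvg|exact: sg_infty|exact: horizon_cvg].
apply: cvg_trans F; apply: near_eq_cvg; near=> n; congr (- _).
apply/esym/killed_sum_at.
- by near: n; exact: nbhs_infty_gt.
- move=> j /andP[j1 jK]; move: j jK j1; near: n.
  apply: near_forall_le => j jK.
  have [->|j1] := posnP j; first by near=> n.
  have : S n j w - H n j @[n --> \oo] --> walk X ul j w - gl j.
    by apply: cvgB; [exact: S_cvg|exact: H_cvg].
  move/cvgr_gt => /(_ 0); rewrite subr_gt0 SJ ?j1// => /(_ isT).
  by apply: filterS => n; rewrite subr_gt0.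
- near: n.
  have : S n K.+1 w - H n K.+1 @[n --> \oo] --> walk X ul K.+1 w - gl K.+1.
    by apply: cvgB; [exact: S_cvg|exact: H_cvg].
  move/cvgr_lt => /(_ 0); rewrite subr_lt0 SK => /(_ isT).
  by apply: filterS => n; rewrite subr_lt0 => /ltW.
Unshelve. all: end_near. Qed.

Let Ex_fn_cvg del : 0 < del ->
  E (fn del n) @[n --> \oo] --> (Num.sqrt (2 + del ^+ 2))^-1 * E Y.
Proof.
move=> del0.
have bcY := bounded_rvZ ((Num.sqrt (2 + del ^+ 2))^-1) bounded_Y.
have [||_ _ D] := @dominated_convergence _ T R P setT measurableT
  (fun n w => (fn del n w)%:E) (fun w => ((Num.sqrt (2 + del ^+ 2))^-1 * Y w)%:E)
  (fun w => (2 * M / del)%:E)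
  (fun n => (measurable_EFinP _ _).2 (bounded_fn del n).1)
  ((measurable_EFinP _ _).2 bcY.1) _
  (bounded_rv_integrable P (@bounded_rv_cst _ T R (2 * M / del))) _.
- have := fn_cvg del0; apply: filterS => w fw _.
  by apply: cvg_EFin fw; near=> n.
- by apply: aeW => w n _; rewrite lee_fin fn_bound.
rewrite -ExZ//.
have : (E (fn del n))%:E @[n --> \oo] --> (E (fun w => (Num.sqrt (2 + del ^+ 2))^-1 * Y w))%:E.
  by rewrite -EFin_Ex//; under eq_fun do rewrite -EFin_Ex//; exact: D.
by move/fine_cvg.
Unshelve. all: end_near. Qed.

(** The parameters are chosen in the order l, delta, n: the window term 96 K M l delta involves l,
    so delta must be small relative to l, and the remaining errors vanish as n grows with both
    fixed. *)
Lemma bounded_case_limit :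
  [/\ bounded_rv Y, 0 <= E Y &
   sg n * E (a n n) @[n --> \oo] --> Num.sqrt (2 / pi) * E Y].
Proof.
set q := E Y; pose c : R := Num.sqrt pi / 2.
have c0 : 0 < c by rewrite divr_gt0// sqrtr_gt0 pi_gt0.
pose K := @survival_const R.
have K0 : 0 < K by apply: lt_le_trans (@survival_const_ge R); rewrite ltr0n.
have KM0 : 0 < K * M by rewrite mulr_gt0.
have s20 : 0 < Num.sqrt 2 :> R by rewrite sqrtr_gt0.
have main : sg n * E (a n n) * c @[n --> \oo] --> (Num.sqrt 2)^-1 * q.
  apply/cvgrPdist_le => e e0.
  have [l [l1 Hl]] : exists l : R, 1 <= l /\ K * M * (c - erf0 l) <= e / 8.
    have := @cvg_erf0 R; move/cvgrPdist_le => /(_ (e / 8 / (K * M))) H0.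
    have /H0 H1 : 0 < e / 8 / (K * M) by rewrite divr_gt0// divr_gt0.
    near (+oo : set_system R) => l; exists l; split.
      by near: l; apply: nbhs_pinfty_ge; rewrite num_real.
    rewrite mulrC -ler_pdivlMr//; apply: le_trans (ler_norm _) _.
    by near: l; exact: H1.
  have [del [del0 Hd1 Hd2]] : exists del : R, [/\ 0 < del,
      96 * (K * M) * (l * del) <= e / 8 &
      `|(Num.sqrt 2)^-1 * q - (Num.sqrt (2 + del ^+ 2))^-1 * q| <= e / 4].
    have D1 : 96 * (K * M) * (l * x) @[x --> 0^'+] --> 96 * (K * M) * (l * 0).
      apply: cvgM; first exact: cvg_cst.
      by apply: cvgM; [exact: cvg_cst|apply: cvg_at_right_filter; exact: cvg_id].
    have D2 : (Num.sqrt (2 + x ^+ 2))^-1 * q @[x --> 0^'+] --> (Num.sqrt 2)^-1 * q.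
      apply: cvgM; last exact: cvg_cst.
      apply: cvgV; first by rewrite gt_eqF.
      apply: continuous_cvg; first exact: sqrt_continuous.
      have D3 : (2 : R) + x ^+ 2 @[x --> 0^'+] --> (2 : R) + 0 ^+ 2.
        apply: cvgD; first exact: cvg_cst.
        by apply: cvg_at_right_filter; exact: exprn_continuous.
      by rewrite expr0n addr0 in D3.
    move/cvgrPdist_le : D1 => /(_ (e / 8)) D1.
    move/cvgrPdist_le : D2 => /(_ (e / 4)) D2.
    have /D1 {}D1 : 0 < e / 8 by rewrite divr_gt0.
    have /D2 {}D2 : 0 < e / 4 by rewrite divr_gt0.
    near (0 : R)^'+ => del; exists del; split.
    - by near: del; exact: nbhs_right_gt.
    - have : `|96 * (K * M) * (l * 0) - 96 * (K * M) * (l * del)| <= e / 8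
        by near: del; exact: D1.
      by rewrite !mulr0 sub0r normrN; apply: le_trans; exact: ler_norm.
    - by near: del; exact: D2.
  have F := Ex_fn_cvg del0.
  move/cvgrPdist_le : F => /(_ (e / 4)) F; have /F {}F : 0 < e / 4 by rewrite divr_gt0.
  (* The part of the bound in [row_estimate] that vanishes as sigma grows. *)
  pose err (s : R) := 38 * M / del ^+ 3 * (s^-1 + M ^+ 2 * (s^-1 * s^-1)
       + K * M * (Num.sqrt s)^-1)
     + 6 * (K * M) * (304 * M / (l * del) ^+ 3) * s^-1.
  have sV : (sg n)^-1 @[n --> \oo] --> (0 : R).
    by apply/gtr0_cvgV0 => //; exact: cvgry_gt.
  have ssV : (Num.sqrt (sg n))^-1 @[n --> \oo] --> (0 : R).
    apply/gtr0_cvgV0.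
      near=> n; rewrite sqrtr_gt0; near: n; exact: cvgry_gt.
    apply/cvgryPge => A; near=> n.
    have [A0|A0] := leP A 0; first exact: le_trans A0 (sqrtr_ge0 _).
    rewrite -(gtr0_norm A0) -sqrtr_sqr ler_wsqrtr//; near: n.
    by move/cvgryPge : sg_infty; exact.
  have errc : err (sg n) @[n --> \oo] --> (0 : R).
    rewrite -[X in _ --> X](_ : 38 * M / del ^+ 3 * (0 + M ^+ 2 * (0 * 0) + K * M * 0)
     + 6 * (K * M) * (304 * M / (l * del) ^+ 3) * 0 = 0); last by ring.
    apply: cvgD; last by apply: cvgM => //; exact: cvg_cst.
    apply: cvgM; first exact: cvg_cst.
    apply: cvgD; last by apply: cvgM => //; exact: cvg_cst.
    by apply: cvgD => //; apply: cvgM; [exact: cvg_cst|exact: cvgM].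
  move/cvgrPdist_le : errc => /(_ (e / 4)) errc.
  have /errc {}errc : 0 < e / 4 by rewrite divr_gt0.
  near=> n.
  have s4 : 4 * M <= sg n by near: n; exact: cvgry_ge.
  have s2 : 2 * M <= del * sg n.
    by rewrite [leRHS]mulrC -ler_pdivrMr//; near: n; exact: cvgry_ge.
  have RE := row_estimate mX indepX bX X0 M0 (UM n) (HM n) del0 l1 s4 s2.
  rewrite /= -/(V n) -/(sg n) -/c -/K overshootE in RE.
  have E1 : `|err (sg n)| <= e / 4.
    by rewrite -normrN -sub0r; near: n; exact: errc.
  have E2 : `|(Num.sqrt (2 + del ^+ 2))^-1 * q - E (fn del n)| <= e / 4.
    by near: n; exact: F.
  have E3 : 38 * M / del ^+ 3 * ((sg n)^-1 + M ^+ 2 / sg n ^+ 2 + K * M / Num.sqrt (sg n))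
    + 6 * (K * M) * (16 * (l * del) + 304 * M / (l * del) ^+ 3 / sg n) =
    err (sg n) + 96 * (K * M) * (l * del).
    have -> : M ^+ 2 / sg n ^+ 2 = M ^+ 2 * ((sg n)^-1 * (sg n)^-1).
      by rewrite -invfM -expr2.
    by rewrite /err; ring.
  have E1' := le_trans (ler_norm _) E1.
  have {}RE : `|sg n * E (a n n) * c - E (fn del n)| <= e / 2.
    apply: le_trans RE _; rewrite addrAC; lra.
  rewrite (_ : _ - _ = ((Num.sqrt 2)^-1 * q - (Num.sqrt (2 + del ^+ 2))^-1 * q)
    + ((Num.sqrt (2 + del ^+ 2))^-1 * q - E (fn del n))
    - (sg n * E (a n n) * c - E (fn del n))); last by ring.
  apply: le_trans (ler_normB _ _) _.
  rewrite [leRHS](_ : _ = e / 4 + e / 4 + e / 2); last by field.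
  apply: lerD => //; apply: le_trans (ler_normD _ _) _; exact: lerD.
have lim : sg n * E (a n n) @[n --> \oo] --> Num.sqrt (2 / pi) * q.
  have -> : Num.sqrt (2 / pi) * q = (Num.sqrt 2)^-1 * q * c^-1.
    have alg (r p x : R) : r * r = 2 -> r != 0 -> p != 0 ->
        r / p * x = r^-1 * x * (2 / p) by move=> <- r0 p0; field; rewrite ?r0 ?p0.
    rewrite sqrtrM// sqrtrV ?pi_ge0// /c invf_div; apply: alg.
    - by rewrite -expr2 sqr_sqrtr.
    - by rewrite gt_eqF.
    - by rewrite gt_eqF// sqrtr_gt0 pi_gt0.
  have F : sg n * E (a n n) * c * c^-1 @[n --> \oo] --> (Num.sqrt 2)^-1 * q * c^-1.
    by apply: cvgM; [exact: main|exact: cvg_cst].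
  apply: cvg_trans F; apply: near_eq_cvg; near=> n.
  by rewrite /= mulfK// gt_eqF.
split => //.
(* The sign of the expectation is read off from the limit, being that of nonnegative quantities. *)
have : 0 <= Num.sqrt (2 / pi) * q.
  apply: (cvgr_to_ge lim); near=> n; rewrite mulr_ge0 ?sqrtr_ge0//.
  by apply: Ex_ge0 => w; exact: alive_ge0.
by rewrite pmulr_rge0// sqrtr_gt0 divr_gt0// pi_gt0.
Unshelve. all: end_near. Qed.

End bounded_case.
(** * Reduction to pointwise bounded variables *)

(** A fixed Borel map applied to each variable, so independence survives; it changes [X i] only on a
    null set, so moments, atoms and probabilities of events survive too. *)
Definition truncation (R : realType) (m x : R) : R := x * \1_`[- m, m] x.

Section truncation.
Variable R : realType.

Lemma truncation_id (m x : R) : `|x| <= m -> truncation m x = x.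
Proof.
rewrite ler_norml => xm; rewrite /truncation indicE mem_set ?mulr1//.
Qed.

Lemma norm_truncation_le (m x : R) : 0 <= m -> `|truncation m x| <= m.
Proof.
move=> m0; rewrite /truncation indicE; have [|_] := boolP (x \in _).
  by rewrite inE/= in_itv/= mulr1 ler_norml.
by rewrite mulr0 normr0.
Qed.

Lemma measurable_truncation (m : R) : measurable_fun setT (truncation m).
Proof. by apply: measurable_funM => //; exact: measurable_indic. Qed.

End truncation.

Section almost_everywhere.
Context d (T : measurableType d) (R : realType) (P : probability T R).

Lemma eq_probability_ae (A B : set T) : measurable A -> measurable B ->
  {ae P, forall w, A w <-> B w} -> P A = P B.
Proof.
move=> mA mB AB; rewrite -[A]setIT -[B]setIT -!integral_indic//.
apply: ae_eq_integral => //.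
- by apply/measurable_EFinP; exact: measurable_indic.
- by apply/measurable_EFinP; exact: measurable_indic.
apply: filterS AB => w AB _; rewrite !indicE; congr ((nat_of_bool _)%:R%:E).
by apply/idP/idP; rewrite !inE => /AB.
Qed.

Lemma probability1_ae (A : set T) : measurable A -> P A = 1%E ->
  {ae P, forall w, A w}.
Proof.
move=> mA PA; exists (~` A); split; [exact: measurableC| |by []].
by rewrite probability_setC// PA subee.
Qed.

(** For y < x the mass at x plus the distribution function at y is at most its value at x; let y
    increase to x and cancel. *)
Lemma cdf_continuous_noatom (X : {RV P >-> R}) (x : R) :
  continuous (cdf X) -> P [set w | X w = x] = 0%E.
Proof.
move=> cX.
have mX (B : set R) : measurable B -> measurable (X @^-1` B).
  by move=> mB; rewrite -[X in measurable X]setTI; exact: measurable_funP.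
have mA : measurable [set w | X w = x] := mX _ (measurable_set1 x).
have H y : y < x -> (P [set w | X w = x] + cdf X y <= cdf X x)%E.
  move=> yx; rewrite /cdf /distribution /pushforward -measureU//; first last.
  - apply/seteqP; split => // w [/= ->]; rewrite in_itv/=; by rewrite leNgt yx.
  - exact: mX.
  apply: le_measure; rewrite ?inE.
  - apply: measurableU => //.
    exact: mX.
  - exact: mX.
  - move=> w [/= ->|/=]; rewrite !in_itv/= ?lexx// => /le_trans; apply; exact: ltW.
have fx : cdf X x \is a fin_num by rewrite fin_num_measure.
have L : (P [set w | X w = x] + cdf X y)%E @[y --> x^'-] --> (P [set w | X w = x] + cdf X x)%E.
  apply: cvgeD; last 2 first.
  - exact: cvg_cst.
  - exact: cvg_at_left_filter (cX x).
  by rewrite fin_num_adde_defl.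
have : (P [set w | X w = x] + cdf X x <= cdf X x)%E.
  apply: (cvge_to_le L); near=> y; apply: H; near: y; exact: nbhs_left_lt.
rewrite -[X in (_ <= X)%E]add0e leeD2rE// => h.
by apply/eqP; rewrite eq_le h measure_ge0.
Unshelve. all: end_near. Qed.

End almost_everywhere.

Theorem corollary3 (d : measure_display) (T : measurableType d) (R : realType)
    (P : probability T R) (X : nat -> {RV P >-> R}) (Mb : nat -> R)
    (u G : nat -> nat -> R) (ul gl : nat -> R)
    (X_indep : independent_RVs [set i | (1 <= i)%N] X)
    (X_cdf : forall i, (1 <= i)%N -> continuous (cdf (X i)))
    (X_mean : forall i, (1 <= i)%N -> ('E_P[X i] = 0)%E)
    (X_bounded : forall i, (1 <= i)%N ->
       P [set w | `|X i w| <= Mb i] = 1%E)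
    (M_finite :
       (ereal_sup [set (`|u kn.1 kn.2| * Mb kn.1 + `|G kn.1 kn.2|)%R%:E
                  | kn in [set kn : nat * nat | (1 <= kn.1 <= kn.2)%N]]
        < +oo)%E)
    (sigma_infty : row_variance X u n @[n --> \oo] --> +oo)
    (u_cvg : forall k, (1 <= k)%N -> u k n @[n --> \oo] --> ul k)
    (G_cvg : forall k, (1 <= k)%N -> G k n @[n --> \oo] --> gl k)
    (tau_finite :
       P [set w | first_passage (weighted_sum X ul w) gl = None] = 0%E)
    (no_contact : ~ degenerate_contact ul gl) :
  let tau_ n w := first_passage (weighted_sum X (u^~ n) w) (G^~ n) in
  let tau w := first_passage (weighted_sum X ul w) gl in
  let minus_U_tau w := - stopped (weighted_sum X ul w) (tau w) in
  [/\ P.-integrable setT (EFin \o minus_U_tau),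
      (0 <= 'E_P[minus_U_tau])%E &
      Num.sqrt (row_variance X u n)
        * fine (P [set w | passage_after (tau_ n w) n]) @[n --> \oo]
      --> Num.sqrt (2 / pi) * fine ('E_P[minus_U_tau])%E].
Proof.
pose Y i := truncation (Mb i) \o X i.
have mX i : measurable_fun setT (X i) := measurable_funP (X i).
have mXB i (B : set R) : measurable B -> measurable (X i @^-1` B).
  by move=> mB; rewrite -[X in measurable X]setTI; exact: mX.
have mY i : measurable_fun setT (Y i).
  by apply: measurableT_comp; [exact: measurable_truncation|exact: mX].
have Mb0 i : (1 <= i)%N -> 0 <= Mb i.
  move=> i1; rewrite leNgt; apply/negP => Mi; have := X_bounded i i1.
  rewrite (_ : [set _ | _] = set0) ?measure0; first by move=> /eqP; rewrite eq_sym onee_eq0.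
  by apply/seteqP; split => // w /= /(le_trans (normr_ge0 _)); rewrite leNgt Mi.
have YX : {ae P, forall w i, (1 <= i)%N -> Y i w = X i w}.
  apply: ae_foralln => i; have [->|i1] := posnP i; first by apply: aeW.
  have mB : measurable [set w | `|X i w| <= Mb i].
    rewrite (_ : [set _ | _] = X i @^-1` `[- Mb i, Mb i]); first exact: mXB.
    by apply/seteqP; split => w /=; rewrite in_itv/= ler_norml.
  have := probability1_ae mB (X_bounded i i1).
  by apply: filterS => w /= Xw _; exact: truncation_id.
have walkYX v : {ae P, forall w k, walk Y v k w = weighted_sum X v w k}.
  apply: filterS YX => w Yw k; rewrite walk.unlock /weighted_sum.
  by apply: eq_big_nat => i /andP[i1 _]; rewrite Yw.
have walkX v w : weighted_sum X v w = (fun k => walk (fun i => X i : T -> R) v k w).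
  by apply/funext => k; rewrite walk.unlock.
have indepY : independent_seq P Y.
  move=> J B J1 mB; apply: (X_indep J (fun i => truncation (Mb i) @^-1` B i)) => // i iJ.
  by rewrite -[X in measurable X]setTI; apply: measurable_truncation => //; exact: mB.
have noatom i x : (1 <= i)%N -> P [set w | Y i w = x] = 0%E.
  move=> i1; rewrite -(cdf_continuous_noatom x (X_cdf i i1)).
  apply: eq_probability_ae.
  - by rewrite -[X in measurable X]setTI; exact: mY i measurableT _ (measurable_set1 x).
  - exact: mXB (measurable_set1 x).
  - by apply: filterS YX => w /(_ i i1) /= ->.
have EY (f g : T -> R) : measurable_fun setT f -> measurable_fun setT g ->
    {ae P, forall w, f w = g w} -> ('E_P[f] = 'E_P[g])%E.
  move=> mf mg fg; rewrite unlock; apply: ae_eq_integral => //.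
  - exact/measurable_EFinP.
  - exact/measurable_EFinP.
  - by apply: filterS fg => w fgw _; rewrite /= fgw.
have ExE (f : T -> R) : fine 'E_P[f] = Ex P f by rewrite Ex.unlock unlock.
have Y0 i : (1 <= i)%N -> Ex P (Y i) = 0.
  move=> i1; rewrite -ExE (EY _ (X i))// ?X_mean//.
  by apply: filterS YX => w; exact.
have YM i w : (1 <= i)%N -> `|Y i w| <= Mb i.
  by move=> i1; apply: norm_truncation_le; exact: Mb0.
have [M M0 uGM] : exists2 M : R, 0 < M & forall k n, (1 <= k <= n)%N ->
    `|u k n| * Mb k + `|G k n| <= M.
  move: M_finite; set s := ereal_sup _ => soo.
  (* The maximum with 1 secures strict positivity even if the supremum is 0. *)
  exists (Num.max 1 (fine s)); first by rewrite lt_max ltr01.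
  move=> k n kn; rewrite le_max; apply/orP; right.
  have : ((`|u k n| * Mb k + `|G k n|)%:E <= s)%E.
    by apply: ereal_sup_ubound; exists (k, n).
  by case: s soo => [r _| //|_]; rewrite ?leeNy_eq// lee_fin.
have varE n : row_variance X u n = walk_var P Y (cut u n) n.
  rewrite walk_var.unlock /row_variance; apply: eq_big_nat => k /andP[k1 kn].
  rewrite step_var.unlock /cut k1 -ltnS kn -ExE; congr (_ * fine _).
  apply: EY; [exact: measurable_funX|exact: measurable_funX|].
  by apply: filterS YX => w /(_ k k1) ->.
have var_infty : walk_var P Y (cut u n) n @[n --> \oo] --> +oo.
  by under eq_fun do rewrite -varE.
have tauY : {ae P, forall w, first_passage (fun k => walk Y ul k w) gl =
    first_passage (weighted_sum X ul w) gl}.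
  by apply: filterS (walkYX ul) => w h; congr first_passage; apply/funext => k; exact: h.
have tauY_finite : {ae P, forall w, first_passage (fun k => walk Y ul k w) gl <> None}.
  have mN : measurable [set w | first_passage (weighted_sum X ul w) gl = None].
    (* Never exiting is surviving every n, which makes the null event measurable. *)
    rewrite (_ : [set _ | _] = \bigcap_n [set w | passage_after
      (first_passage (fun k => walk (fun i => X i : T -> R) ul k w) gl) n]).
      by apply: bigcapT_measurable => n; exact: measurable_survival.
    apply/seteqP; split => w /=; rewrite walkX; first by move=> h n _ /=; rewrite h.
    by case E1 : first_passage => [K|//] h; have := h K I; rewrite /= E1 /= ltnn.
  have : {ae P, forall w, first_passage (weighted_sum X ul w) gl <> None}.
    exists [set w | first_passage (weighted_sum X ul w) gl = None]; split => //.
    by move=> w /= /contrapT.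
  by move=> nN; apply: filterS2 tauY nN => w ->.
have [bY Y_ge0 lim] := bounded_case_limit mY indepY noatom Y0 YM M0 uGM var_infty
  u_cvg G_cvg no_contact tauY_finite.
move=> tau_ tau minus_U_tau.
have mU : measurable_fun setT minus_U_tau.
  have -> : minus_U_tau = minus_stopped (fun i => X i : T -> R) ul gl.
    by apply/funext => w; rewrite /minus_U_tau /tau /minus_stopped walkX.
  exact: measurable_minus_stopped.
have UY : {ae P, forall w, minus_stopped Y ul gl w = minus_U_tau w}.
  apply: filterS (walkYX ul) => w h; rewrite /minus_stopped /minus_U_tau /tau.
  by rewrite (_ : (fun k => walk Y ul k w) = weighted_sum X ul w)//; apply/funext.
have EU : ('E_P[minus_U_tau] = (Ex P (minus_stopped Y ul gl))%:E)%E.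
  by rewrite -(EY _ _ bY.1 mU UY) unlock EFin_Ex.
split.
- have /integrableP[_ iY] := bounded_rv_integrable P bY.
  apply/integrableP; split; first exact/measurable_EFinP.
  rewrite (_ : (\int[P]_x _)%E = (\int[P]_x `|(EFin \o minus_stopped Y ul gl) x|)%E)//.
  apply: ae_eq_integral => //.
  + by apply/measurable_EFinP; exact: measurableT_comp.
  + by apply/measurable_EFinP; apply: measurableT_comp => //; exact: bY.1.
  + by apply: filterS UY => w /= ->.
- by rewrite EU lee_fin.
rewrite EU /=; apply: cvg_trans lim; apply: near_eq_cvg; apply: nearW => n /=.
rewrite varE; congr (_ * _).
rewrite (_ : alive Y (cut u n) (cut G n) n =
  \1_[set w | passage_after
    (first_passage (fun k => walk Y (cut u n) k w) (cut G n)) n]); last first.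
  apply/funext => w; rewrite indicE; have [|] := boolP (w \in _).
    by rewrite inE /= => /passage_afterP h; exact/aliveP.
  rewrite notin_setE /= => h; case: (alive01 Y (cut u n) (cut G n) n w) => // /aliveP h'.
  by exfalso; apply: h; exact/passage_afterP.
rewrite Ex_indic; last exact: measurable_survival.
congr fine; apply: eq_probability_ae.
- exact: measurable_survival.
- have -> : [set w | passage_after (tau_ n w) n] = [set w | passage_after
      (first_passage (fun k => walk (fun i => X i : T -> R) (u^~ n) k w) (G^~ n)) n].
    by apply/funext => w /=; rewrite /tau_ walkX.
  exact: measurable_survival.
apply: filterS (walkYX (u^~ n)) => w h /=; rewrite /tau_.
(* The event tau_n > n looks only at indices up to n, where the cut row and the full row agree. *)
have cutE j : (1 <= j <= n)%N -> walk Y (cut u n) j w = weighted_sum X (u^~ n) w j.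
  move=> /andP[j1 jn]; rewrite -h walk.unlock; apply: eq_big_nat => i /andP[i1 ij].
  by rewrite /cut i1 (leq_trans _ jn).
have cutG j : (1 <= j <= n)%N -> cut G n j = G j n by move=> jn; rewrite /cut jn.
by split => /passage_afterP H; apply/passage_afterP => j jn; have := H j jn;
  rewrite cutE// cutG.
Qed.
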